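(* Consider the relative velocity lattice Boltzmann scheme $D_dQ_q$ with one conservation law (on the density $\rho=\sum_{j=0}^{q-1} f_j$), with an arbitrary velocity field $\widetilde{u}(x,t)\in\mathbb{R}^d$, arbitrary dimension $d$, arbitrary number $q$ of velocities and arbitrary equilibrium, as described in the context. Write $\Delta=\Delta t$, and let $\Delta t,\Delta x\to 0$ with $\lambda=\Delta x/\Delta t$ and the relaxation parameters $s_k$ fixed. Then the third order conservation equation on the density is $$ \begin{aligned} &\partial_t \rho+\sum_{\beta=1}^d \partial_\beta\big((q^{eq})^{\beta}\big)-\Delta\sum_{\beta=1}^d\sigma_\beta\,\partial_\beta\big(\theta_\beta(0)\big)\\ &\quad=-\Delta^2 \sum_{\beta=1}^d\sum_{j=0}^{q-1}\sum_{l=1}^{q-1}\sigma_\beta\,\sigma_l\, v_j^{\beta}\,\partial_\beta\Big(\mathrm{d}_t^j\big(M(\widetilde{u})^{-1}_{jl}\,\theta_l(\widetilde{u})\big)\Big)\\ &\qquad+\frac{\Delta^2}{12}\sum_{\beta,\gamma=1}^d\sum_{j=0}^{q-1} v_j^{\beta}v_j^{\gamma}\,\partial_{\beta}\partial_\gamma\big(\mathrm{d}_t^j f_j^{eq}\big)+\frac{\Delta^2}{6}\sum_{\beta=1}^d\partial_\beta\partial_t\big(\theta_\beta(0)\big)+\mathcal{O}(\Delta^3), \end{aligned} $$ where $q^{eq}=\sum_{j=0}^{q-1} v_j f_j^{eq}$ is the momentum at equilibrium, $\mathrm{d}_t^j=\partial_t+\sum_{\alpha=1}^d v_j^\alpha\partial_\alpha$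 ($0\le j\le q-1$) is the particular derivative, $\theta_k(\widetilde{u})=\sum_{j=0}^{q-1}M(\widetilde{u})_{kj}\,\mathrm{d}_t^j f_j^{eq}$ ($0\le k\le q-1$) is the conservation default ($\theta_k(0)$ being the same expression with $M(0)$ in place of $M(\widetilde{u})$), and $\sigma_k=\frac{1}{s_k}-\frac12$ is the Hénon parameter, defined for each $0\le k\le q-1$ with $s_k\neq 0$.
   Context: **The scheme.** Let $\mathcal{L}$ be a cartesian lattice in dimension $d$ with mesh size $\Delta x$; the time step is $\Delta t=\Delta x/\lambda$, with $\lambda$ a fixed velocity scale. Write $\Delta=\Delta t$. Let $v_0,\dots,v_{q-1}\in\mathbb{R}^d$ be velocities such that $x+v_j\Delta t\in\mathcal{L}$ for each $x\in\mathcal{L}$ and each $j$; $v_j^\alpha$ denotes the $\alpha$-th component of $v_j$, and $\partial_\alpha$ denotes $\partial/\partial x_\alpha$, $1\le\alpha\le d$. The unknowns are the particle distributions $f=(f_0,\dots,f_{q-1})$, functions of $(x,t)$. Let $P_0,\dots,P_{q-1}\in\mathbb{R}[X_1,\dots,X_d]$ be polynomials with $P_0=1$ and $P_k=X_k$ for $1\le k\le d$. For $u\in\mathbb{R}^d$, the matrix of moments is $M(u)_{kj}=P_k(v_j-u)$, $0\le k,j\le q-1$; it is assumed invertible, and $M(u)^{-1}_{jl}$ denotes the $(j,l)$ entry of its inverse. Let $\widetilde{u}=\widetilde{u}(x,t)\in\mathbb{R}^d$ be a given velocity field. The moments are $m(\widetilde{u})=(m_0(\widetilde u),\dots,m_{q-1}(\widetilde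 u))=M(\widetilde{u})f$. One time step consists of: 1. Relaxation (local in $x$ and $t$): $m_k^*(\widetilde{u})=m_k(\widetilde{u})+s_k\big(m_k^{eq}(\widetilde{u})-m_k(\widetilde{u})\big)$, $0\le k\le q-1$, followed by $f^*=M(\widetilde{u})^{-1}m^*(\widetilde{u})$. 2. Transport: $f_j(x,t+\Delta t)=f_j^*(x-v_j\Delta t,t)$, $0\le j\le q-1$. The equilibrium moments are $m^{eq}(\widetilde{u})=M(\widetilde{u})f^{eq}$, where the equilibrium distribution $f^{eq}=(f_0^{eq},\dots,f_{q-1}^{eq})$ is independent of $\widetilde{u}$. There is one conservation law, on the density $\rho=\sum_{j}f_j$: $f^{eq}$ is a function of $\rho$ with $\sum_j f_j^{eq}=\rho$; $s_0=0$, and $s_k\neq0$ for $1\le k\le q-1$. The relaxation parameters $s_k$ are constants. **Meaning of the expansion.** The expansion is a formal one as $\Delta\to0$: the distributions are assumed to be the restrictions to the lattice of sufficiently regular functions of $(x,t)$ ($\widetilde u$ and $f^{eq}$ being also sufficiently regular), so that the Taylor formula may be applied to the transport relation to any order and identities with $\mathcal{O}(\Delta^p)$ remainders may be differentiated in $x$ and $t$ as often as needed, with remainders of the same order. *)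

(* Defs.v *)
From mathcomp Require Import all_boot all_order all_algebra.
From mathcomp Require Import all_classical all_reals all_analysis.
(* The notations of mpoly clash with those of mathcomp-analysis. *)
From mathcomp Require Import -(notations) mpoly.

Set Implicit Arguments.
Unset Strict Implicit.
Unset Printing Implicit Defensive.

Import Order.TTheory GRing.Theory Num.Theory.
Import numFieldNormedType.Exports.

Local Open Scope classical_set_scope.
Local Open Scope ring_scope.

(* Points (x, t). *)
Notation spacetime R d := ('rV[R]_d * R)%type.

Section Calculus.
Variables (R : realType) (d : nat).
Local Notation spacetime := (spacetime R d).

Definition partial_t (F : spacetime -> R) (z : spacetime) : R :=
  'D_((0, 1) : spacetime) F z.

Definition partial_x (a : 'I_d) (F : spacetime -> R) (z : spacetime) : R :=
  'D_((delta_mx 0 a, 0) : spacetime) F z.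

(* The particular derivative d_t^j, for the velocity w = v_j. *)
Definition particular_derivative (w : 'rV[R]_d) (F : spacetime -> R)
    (z : spacetime) : R :=
  partial_t F z + \sum_(a < d) w 0 a * partial_x a F z.

Definition iter_derive (s : seq spacetime) (F : spacetime -> R) :
    spacetime -> R :=
  foldr (fun v G z => 'D_v G z) F s.

Definition positive_time : set spacetime := [set z | 0 < z.2].

(* Infinite differentiability: differentiability of an iterated derivative
   makes it continuous, so no separate continuity clause is needed. *)
Definition smooth_on (U : set spacetime) (F : spacetime -> R) : Prop :=
  forall (s : seq spacetime) (z : spacetime),
    U z -> differentiable (iter_derive s F) z.

(* F h is a field depending on the time step h. [bigO_field p F] is the meaning
   of "F h = O(h ^ p) as h tends to 0, and this may be differentiated as often
   as needed with a remainder of the same order": all the derivatives of F h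
   are O(h ^ p), uniformly on the compact sets of positive times. *)
Definition bigO_field (p : nat) (F : R -> spacetime -> R) : Prop :=
  (\forall h \near 0^'+, smooth_on positive_time (F h)) /\
  forall (s : seq spacetime) (K : set spacetime),
    compact K -> K `<=` positive_time ->
    exists C : R, \forall h \near 0^'+,
      forall z, K z -> `|iter_derive s (F h) z| <= C * h ^+ p.

(* A family of smooth fields whose derivatives of all orders are locally bounded
   independently of h, so that Taylor's formula applies to any order. *)
Definition regular_field (F : R -> spacetime -> R) : Prop := bigO_field 0 F.

Definition equal_mod_bigO (p : nat) (F G : R -> spacetime -> R) : Prop :=
  bigO_field p (fun h z => F h z - G h z).

Definition smooth (g : R -> R) : Prop :=
  forall (n : nat) (r : R), derivable (derive1n n g) r 1.

End Calculus.

Section Scheme.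
Variables (R : realType) (d q : nat).

(* The index beta of a space coordinate is numbered from 0 in 'I_d; the
   associated moment, P = X_beta, has index beta + 1. *)
Definition momentum_index (hdq : (d < q)%N) (b : 'I_d) : 'I_q :=
  Ordinal (leq_ltn_trans (ltn_ord b) hdq).

Definition cartesian_lattice (origin : 'rV[R]_d) (dx : R) : set 'rV[R]_d :=
  [set x | exists n : 'rV[int]_d, x = origin + dx *: map_mx intr n].

Variables (P : 'I_q -> mpoly d R) (v : 'I_q -> 'rV[R]_d).

Definition moment_matrix (u : 'rV[R]_d) : 'M[R]_q :=
  \matrix_(k, j) meval (fun a => (v j - u) 0 a) (P k).

Variables (s : 'I_q -> R) (feq : R -> 'cV[R]_q).

Definition density (g : 'cV[R]_q) : R := \sum_(j < q) g j 0.

Definition relaxation (u : 'rV[R]_d) (g : 'cV[R]_q) : 'cV[R]_q :=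
  let m := moment_matrix u *m g in
  let meq := moment_matrix u *m feq (density g) in
  let mstar := \col_k (m k 0 + s k * (meq k 0 - m k 0)) in
  invmx (moment_matrix u) *m mstar.

(* One run of the scheme with time step h, on the lattice L and at the times
   0, h, 2h, ... *)
Definition lattice_boltzmann (h : R) (L : set 'rV[R]_d)
    (ut : spacetime R d -> 'rV[R]_d) (f : spacetime R d -> 'cV[R]_q) : Prop :=
  forall (x : 'rV[R]_d) (n : nat) (j : 'I_q), L x ->
    let t := n%:R * h in
    let y := x - h *: v j in
    f (x, t + h) j 0 = relaxation (ut (y, t)) (f (y, t)) j 0.

Definition henon (k : 'I_q) : R := (s k)^-1 - 2^-1.

(* fe is the equilibrium distribution as a field on space-time. *)
Variable fe : spacetime R d -> 'cV[R]_q.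

Definition equilibrium_momentum (b : 'I_d) (z : spacetime R d) : R :=
  \sum_(j < q) v j 0 b * fe z j 0.

Definition conservation_default (k : 'I_q) (u : spacetime R d -> 'rV[R]_d)
    (z : spacetime R d) : R :=
  \sum_(j < q) moment_matrix (u z) k j *
    particular_derivative (v j) (fun y => fe y j 0) z.

End Scheme.

(* Main.v *)
Require Import Defs.
From mathcomp Require Import all_boot all_order all_algebra.
From mathcomp Require Import all_classical all_reals all_analysis.
From mathcomp Require Import -(notations) mpoly.
From mathcomp Require Import ring lra.

Set Implicit Arguments.
Unset Strict Implicit.
Unset Printing Implicit Defensive.

Import Order.TTheory GRing.Theory Num.Theory.
Import numFieldNormedType.Exports.

Local Open Scope classical_set_scope.
Local Open Scope ring_scope.

(** The transport relation, which only holds on the lattice, first extends to all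
points up to O(h^p) for every p: a family of smooth fields with bounded
derivatives which vanishes on grids of step O(h) is O(h^p) with all its
derivatives, because its difference quotients along the grid vanish on the grid
too. Taylor's formula then gives f^* - f = h D f + h^2/2 D^2 f + h^3/6 D^3 f + O(h^4),
where D_j is the particular derivative.

Inverting the relaxation, e - f = K (f^* - f) for the equilibrium e, with K regular.
This yields successively f = e + O(h) and f = e - h T - h/2 D e + O(h^2), where
T = M^-1 diag(sigma) theta, and then f^* - f = h D e - h^2 D T + O(h^3). The
density row of the moments sums f^* - f to 0; its expansion is the conservation
equation, in which the first moments of f are replaced by those of e using the
momentum rows e - f = (f^* - f) / s_b. The density row at second order also gives
theta_0 = h sum_b sigma_b d_b theta_b + O(h^2), which removes the time derivatives of
theta_0 and makes the terms sigma_b d_t d_b theta_b cancel. *)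

(** * Smooth functions of positive times *)

(** A remainder is useful here only if it may be differentiated, so O(h^p) must bound all iterated
    derivatives uniformly on compact sets. Most such bounds come from coinduction: a class of
    families stable under derivation is exhibited, and only its members themselves are estimated.
    Algebraic operations, compositions, inverses, translates and Taylor remainders are treated in
    this way. The extension off the lattice resists it, because the derivative of a field that
    vanishes on a grid need not vanish there; that step needs a double induction, on the order p and
    on the sequence of derivatives.

    The jump f^* - f is expanded up to O(h^4) because the conservation equation is its density row
    divided by h. Relaxation cannot be inverted on that row, where s_0 = 0. The row is therefore
    left out of K, which puts a multiple of theta_0 into the expansion of f; it is absorbed because
    theta_0 = O(h). *)

Section NearEq.
Context {R : realType} {V W : normedModType R}.

(** The affine expansion of [f] at [a] is also one of [g], since both have the same germ; uniqueness
    of the differential then identifies ['d g a]. *)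
Lemma near_eq_differentiable (f g : V -> W) (a : V) :
  (\near a, f a = g a) -> differentiable f a -> differentiable g a.
Proof.
move=> fg df; have fga : f a = g a by exact: (nbhs_singleton fg).
have E : g \o shift a = cst (g a) + 'd f a +o_ 0 id.
  apply/eqaddoP => _/posnumP[e].
  have /eqaddoP/(_ e%:num (gt0 e)) H := diff_locally df.
  have fg0 : \forall h \near (0 : V), f (h + a) = g (h + a).
    by move: fg; rewrite (near_shift 0 a); apply: filterS => x /=; rewrite subr0.
  apply: filterS2 H fg0 => h Hh Hg; apply: le_trans Hh.
  by rewrite !fctE /= fga Hg.
have dE := diff_unique (diff_continuous df) E.
by apply/diff_locallyP; rewrite dE; split => //; exact: diff_continuous.
Qed.

End NearEq.

Section Smooth.
Context {R : realType} {d : nat}.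
Local Notation spacetime := (spacetime R d).
Local Notation pos := (@positive_time R d).
Implicit Types (F G : spacetime -> R) (z v w : spacetime).

Lemma open_positive_time : open pos.
Proof.
have -> : pos = snd @^-1` [set t : R | 0 < t] by [].
apply: open_comp; last exact: open_gt.
by move=> z _; exact: cvg_snd.
Qed.

Lemma near_positive_time z : pos z -> \near z, pos z.
Proof. by move=> pz; apply: open_nbhs_nbhs; split => //; exact: open_positive_time. Qed.

(** Fields are uncontrolled at times t <= 0. Since positive times form an open set, this equality
    passes to all derivatives. *)
Definition eq_pos F G := forall z, pos z -> F z = G z.

Lemma eq_pos_near F G z : eq_pos F G -> pos z -> \near z, F z = G z.
Proof. by move=> FG pz; near=> y; apply: FG; near: y; exact: near_positive_time.
Unshelve. all: by end_near. Qed.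

Lemma eq_pos_derive v F G : eq_pos F G -> eq_pos ('D_v F) ('D_v G).
Proof. by move=> FG z pz; apply: near_eq_derive; exact: eq_pos_near. Qed.

Lemma eq_pos_differentiable F G : eq_pos F G ->
  forall z, pos z -> differentiable F z -> differentiable G z.
Proof. by move=> FG z pz; apply: near_eq_differentiable; exact: eq_pos_near. Qed.

Lemma eq_pos_iter_derive s F G : eq_pos F G ->
  eq_pos (iter_derive s F) (iter_derive s G).
Proof. by move=> FG; elim: s => //= v s IH; exact: eq_pos_derive. Qed.

Lemma iter_derive_rcons s v F :
  iter_derive (rcons s v) F = iter_derive s ('D_v F).
Proof. by rewrite /iter_derive foldr_rcons. Qed.

Lemma iter_derive_cat s1 s2 F :
  iter_derive (s1 ++ s2) F = iter_derive s1 (iter_derive s2 F).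
Proof. by rewrite /iter_derive foldr_cat. Qed.

(* Coinduction: a class of functions stable under derivation consists of
   infinitely differentiable functions. *)
Lemma smooth_coind (C : (spacetime -> R) -> Prop) :
  (forall F z, C F -> pos z -> differentiable F z) ->
  (forall F v, C F -> exists2 G, C G & eq_pos ('D_v F) G) ->
  forall F, C F -> smooth_on pos F.
Proof.
move=> Cd CD F CF s.
suff [G CG FG] : exists2 G, C G & eq_pos (iter_derive s F) G.
  move=> z pz; apply: (eq_pos_differentiable (F := G)) => //.
    by move=> y py; rewrite FG.
  exact: Cd.
elim: s => [|v s [G CG FG]]; first by exists F.
have [H CH GH] := CD G v CG; exists H => // z pz.
by rewrite -GH //=; exact: eq_pos_derive.
Qed.

Lemma smooth_differentiable F z : smooth_on pos F -> pos z -> differentiable F z.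
Proof. by move=> sF pz; exact: (sF [::]). Qed.

Lemma smooth_derivable F z v : smooth_on pos F -> pos z -> derivable F z v.
Proof. by move=> sF pz; apply: diff_derivable; exact: smooth_differentiable. Qed.

Lemma smooth_derive v F : smooth_on pos F -> smooth_on pos ('D_v F).
Proof. by move=> sF s z pz; rewrite -iter_derive_rcons; exact: sF. Qed.

Lemma smooth_iter_derive s F : smooth_on pos F -> smooth_on pos (iter_derive s F).
Proof. by move=> sF t z pz; rewrite -iter_derive_cat; exact: sF. Qed.

Lemma smooth_eq_pos F G : eq_pos F G -> smooth_on pos F -> smooth_on pos G.
Proof.
move=> FG sF s z pz; apply: (eq_pos_differentiable (F := iter_derive s F)) => //.
  exact: eq_pos_iter_derive.
exact: sF.
Qed.

End Smooth.

(** * Directional derivatives of compositions and inverses, linearity in the direction *)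

Section DeriveComp.
Context {R : realType} {V : normedModType R}.

Lemma differentiable_comp1 (g : R -> R) (F : V -> R) z :
  derivable g (F z) 1 -> differentiable F z -> differentiable (g \o F) z.
Proof. by move=> /derivable1_diffP dg dF; exact: differentiable_comp. Qed.

Lemma derive_comp1 (g : R -> R) (F : V -> R) z v :
  derivable g (F z) 1 -> differentiable F z ->
  'D_v (g \o F) z = derive1 g (F z) * 'D_v F z.
Proof.
move=> dg dF; have /derivable1_diffP dg' := dg.
rewrite deriveE; last exact: differentiable_comp.
by rewrite diff_comp //= deriv1E // deriveE //= [LHS]mulrC.
Qed.

Lemma derive_inv (F : V -> R) z v : F z != 0 -> differentiable F z ->
  'D_v (fun y => (F y)^-1) z = - ('D_v F z * (F z)^-1 * (F z)^-1).
Proof.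
move=> Fz dF; rewrite deriveV //; last exact: diff_derivable.
by rewrite /GRing.scale /= -exprVn; ring.
Qed.

Lemma derive_dirD (F : V -> R) z v w : differentiable F z ->
  'D_(v + w) F z = 'D_v F z + 'D_w F z.
Proof. by move=> dF; rewrite !deriveE // linearD. Qed.

Lemma derive_dirZ (F : V -> R) z k w : differentiable F z ->
  'D_(k *: w) F z = k * 'D_w F z.
Proof. by move=> dF; rewrite !deriveE // linearZ. Qed.

Lemma derive_dir_sum (F : V -> R) z (I : finType) (w : I -> V) :
  differentiable F z ->
  'D_(\sum_i w i) F z = \sum_i 'D_(w i) F z.
Proof.
by move=> dF; rewrite deriveE // linear_sum; apply: eq_bigr => i _; rewrite deriveE.
Qed.

End DeriveComp.

(** * Mean values and symmetry of second derivatives *)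

Section Line.
Context {R : realType} {V : normedModType R}.

Lemma is_derive_line (F : V -> R) (z w : V) (t : R) :
  derivable F (z + t *: w) w ->
  is_derive t 1 (fun r : R => F (z + r *: w)) ('D_w F (z + t *: w)).
Proof.
move=> dF; rewrite /derivable /derive in dF *.
have E : (fun h : R => h^-1 *: (((fun r : R => F (z + r *: w)) \o shift t) (h *: 1)
          - F (z + t *: w)))
       = (fun h : R => h^-1 *: ((F \o shift (z + t *: w)) (h *: w) - F (z + t *: w))).
  apply/funext => h /=; congr (_ *: (F _ - _)).
  by rewrite [h *: 1]mulr1 scalerDl addrCA.
by split; rewrite /derivable /derive E.
Qed.

Lemma derive_translate (F : V -> R) (a v z : V) :
  'D_v (fun y => F (y + a)) z = 'D_v F (z + a).
Proof.
rewrite /derive.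
have E : (fun h : R => h^-1 *: (((fun y => F (y + a)) \o shift z) (h *: v) - F (z + a)))
       = (fun h : R => h^-1 *: ((F \o shift (z + a)) (h *: v) - F (z + a))).
  by apply/funext => h /=; rewrite addrA.
by rewrite E.
Qed.

Lemma differentiable_translate (F : V -> R) (a z : V) :
  differentiable F (z + a) -> differentiable (fun y => F (y + a)) z.
Proof.
move=> dF; apply: (@differentiable_comp _ _ _ _ (fun y => y + a) F) => //.
Qed.

Lemma mvt_line (F : V -> R) (z w : V) (T : R) : 0 <= T ->
  (forall t, 0 <= t <= T -> differentiable F (z + t *: w)) ->
  exists2 t, 0 <= t <= T & F (z + T *: w) - F z = T * 'D_w F (z + t *: w).
Proof.
move=> T0 dF.
have dl t : 0 <= t <= T -> is_derive t 1 (fun r : R => F (z + r *: w)) ('D_w F (z + t *: w)).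
  by move=> tT; apply: is_derive_line; apply: diff_derivable; exact: dF.
have [||t tT E] := @MVT_segment R (fun r : R => F (z + r *: w))
  (fun t => 'D_w F (z + t *: w)) 0 T T0.
- by move=> t; rewrite in_itv /= => /andP[t0 tT]; apply: dl; rewrite !ltW.
- apply: derivable_within_continuous => t; rewrite in_itv /= => tT.
  by have [] := dl t tT.
exists t; first by move: tT; rewrite in_itv.
by move: E; rewrite scale0r addr0 subr0 mulrC.
Qed.

(* The second-order difference is evaluated in the two possible orders by the
   mean value theorem. *)
Lemma second_difference (F : V -> R) (z u v : V) (T : R) : 0 <= T ->
  (forall a b, 0 <= a <= T -> 0 <= b <= T -> differentiable F (z + a *: u + b *: v)) ->
  (forall a b, 0 <= a <= T -> 0 <= b <= T ->
    differentiable ('D_u F) (z + a *: u + b *: v)) ->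
  exists a b, [/\ 0 <= a <= T, 0 <= b <= T &
    F (z + T *: u + T *: v) - F (z + T *: u) - (F (z + T *: v) - F z)
    = T ^+ 2 * 'D_v ('D_u F) (z + a *: u + b *: v)].
Proof.
move=> T0 dF ddF.
have T00 : 0 <= (0 : R) <= T by rewrite lexx.
have TT : 0 <= T <= T by rewrite lexx T0.
have dG t : 0 <= t <= T ->
  differentiable (fun y => F (y + T *: v) - F y) (z + t *: u).
  move=> tT; apply: (@differentiableB _ _ _ (fun y => F (y + T *: v)) F).
    by apply: differentiable_translate; exact: dF.
  by have := dF t 0 tT T00; rewrite scale0r addr0.
have [a aT E] := mvt_line T0 dG.
have [|b bT E2] := @mvt_line ('D_u F) (z + a *: u) v T T0.
  by move=> b bT; exact: ddF.
exists a, b; split => //.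
have -> : F (z + T *: u + T *: v) - F (z + T *: u) - (F (z + T *: v) - F z) =
  T * 'D_u (fun y => F (y + T *: v) - F y) (z + a *: u) by rewrite -E.
rewrite expr2 -mulrA -E2; congr (_ * _).
have dT : differentiable (fun y => F (y + T *: v)) (z + a *: u).
  by apply: differentiable_translate; exact: dF.
have da : differentiable F (z + a *: u).
  by have := dF a 0 aT T00; rewrite scale0r addr0.
rewrite (deriveB (@diff_derivable _ _ _ _ _ u dT) (@diff_derivable _ _ _ _ _ u da)).
by rewrite derive_translate.
Qed.

End Line.

Section Schwarz.
Context {R : realType} {V : normedModType R}.

(** Schwarz's theorem. The second difference over a small parallelogram does not depend on the order
    of [u] and [v], so the two mixed derivatives take a common value at two points near [z];
    continuity at [z] concludes. *)
Lemma derive_comm (F : V -> R) (u v z : V) :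
  (\near z, [/\ differentiable F z, differentiable ('D_u F) z
     & differentiable ('D_v F) z]) ->
  {for z, continuous ('D_v ('D_u F))} -> {for z, continuous ('D_u ('D_v F))} ->
  'D_v ('D_u F) z = 'D_u ('D_v F) z.
Proof.
move=> dF cvu cuv; apply/eqP; rewrite -subr_eq0 -normr_le0; apply/ler_addgt0Pr => e e0.
rewrite add0r.
have e20 : 0 < e / 2 by rewrite divr_gt0.
have near2 : \forall y \near z, [/\ [/\ differentiable F y, differentiable ('D_u F) y
     & differentiable ('D_v F) y],
    `|'D_v ('D_u F) z - 'D_v ('D_u F) y| < e / 2 &
    `|'D_u ('D_v F) z - 'D_u ('D_v F) y| < e / 2].
  move/cvgrPdist_lt: cvu => /(_ _ e20) cvu.
  move/cvgrPdist_lt: cuv => /(_ _ e20) cuv.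
  apply: filterS (filterI dF (filterI cvu cuv)) => y [H1 [H2 H3]].
  exact: And3 H1 H2 H3.
have [r r0 Br] := iffLR (nbhs_normP _ _) near2.
(* This size keeps the parallelogram inside the ball of radius [r]; the added 1 covers the case
   where [u] and [v] are both zero. *)
pose T := r / 2 / (`|u| + `|v| + 1).
have N0 : 0 < `|u| + `|v| + 1 by rewrite ltr_wpDl // addr_ge0.
have T0 : 0 < T by rewrite !divr_gt0.
have inB a b : 0 <= a <= T -> 0 <= b <= T -> ball_ Num.norm z r (z + a *: u + b *: v).
  move=> /andP[a0 aT] /andP[b0 bT] /=.
  rewrite -addrA opprD addNKr normrN.
  apply: le_lt_trans (ler_normD _ _) _; rewrite !normrZ !ger0_norm //.
  apply: (@le_lt_trans _ _ (T * (`|u| + `|v|))).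
    by rewrite mulrDr lerD // ler_wpM2r.
  apply: (@le_lt_trans _ _ (T * (`|u| + `|v| + 1))).
    by rewrite ler_wpM2l ?ltW // ltrDl.
  by rewrite divfK ?gt_eqF // ltr_pdivrMr // ltr_pMr // ltr1n.
have [|||a [b [aT bT E1]]] := @second_difference R V F z u v T.
- exact: ltW.
- by move=> a b aT bT; have [[]] := Br _ (inB a b aT bT).
- by move=> a b aT bT; have [[]] := Br _ (inB a b aT bT).
have inB' a' b' : 0 <= a' <= T -> 0 <= b' <= T -> ball_ Num.norm z r (z + a' *: v + b' *: u).
  by move=> aT' bT'; rewrite addrAC; exact: inB.
have [|||a' [b' [aT' bT' E2]]] := @second_difference R V F z v u T.
- exact: ltW.
- by move=> a' b' aT' bT'; have [[]] := Br _ (inB' a' b' aT' bT').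
- by move=> a' b' aT' bT'; have [[]] := Br _ (inB' a' b' aT' bT').
have E : 'D_v ('D_u F) (z + a *: u + b *: v) = 'D_u ('D_v F) (z + a' *: v + b' *: u).
  have : T ^+ 2 != 0 by rewrite expf_neq0 // gt_eqF.
  move=> /mulfI; apply; refine (etrans (esym E1) (etrans _ E2)); rewrite (addrAC z (T *: v)).
  move: (F _) (F _) (F _) (F _) => c1 c2 c3 c4.
  by rewrite !opprB addrACA [RHS]addrACA; congr (_ + _); rewrite addrC.
have [_ B1 _] := Br _ (inB a b aT bT).
have [_ _ B2] := Br _ (inB' a' b' aT' bT').
rewrite [leRHS]splitr; apply/ltW; apply: le_lt_trans (ltrD B1 B2).
rewrite E [X in _ <= _ + X]distrC; apply: le_trans (ler_normD _ _).
by rewrite addrA subrK.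
Qed.

End Schwarz.

Section SmoothDerive.
Context {R : realType} {d : nat}.
Local Notation spacetime := (spacetime R d).
Local Notation pos := (@positive_time R d).
Implicit Types (F G : spacetime -> R) (z v w : spacetime).

Lemma smooth_derive_comm F u v : smooth_on pos F ->
  eq_pos ('D_v ('D_u F)) ('D_u ('D_v F)).
Proof.
move=> sF z pz; apply: derive_comm.
- apply: filterS (near_positive_time pz) => y py; split.
  + exact: (sF [::]).
  + exact: (sF [:: u]).
  + exact: (sF [:: v]).
- by apply: differentiable_continuous; exact: (sF [:: v; u]).
- by apply: differentiable_continuous; exact: (sF [:: u; v]).
Qed.

End SmoothDerive.

(** * Families of fields depending on the time step *)

Section Boxes.
Context {R : realType} {d : nat}.
Local Notation spacetime := (spacetime R d).
Local Notation pos := (@positive_time R d).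

(** A one-parameter exhaustion of the positive times by compact sets, growing as [r] decreases to 0.
    Uniform bounds on compact sets need only be tested on boxes. *)
Definition box (r : R) : set spacetime :=
  [set z : spacetime | (forall a, `|z.1 0 a| <= r^-1) /\ r <= z.2 <= r^-1].

Lemma box_positive r : 0 < r -> box r `<=` pos.
Proof. by move=> r0 z [_ /andP[rz _]]; exact: lt_le_trans rz. Qed.

Lemma compact_box r : compact (box r).
Proof.
have -> : box r = [set x : 'rV[R]_d | forall a, `[- r^-1, r^-1]%classic (x ord0 a)]
                    `*` `[r, r^-1]%classic.
  apply/seteqP; split => z [H1 H2]; split.
  - by move=> a; rewrite /= in_itv /= -ler_norml.
  - by rewrite /= in_itv.
  - by move=> a; have := H1 a; rewrite /= in_itv /= -ler_norml.
  - by move: H2; rewrite /= in_itv.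
apply: compact_setX; last exact: segment_compact.
by apply: (@rV_compact R d (fun=> `[- r^-1, r^-1]%classic)) => a; exact: segment_compact.
Qed.

Lemma coord_le_norm (w : spacetime) a : `|w.1 0 a| <= `|w|.
Proof.
apply: (@le_trans _ _ `|w.1|); last by rewrite [leRHS]/Num.norm /= le_max lexx.
rewrite [leRHS]mx_normrE.
exact: (le_bigmax _ (fun i : 'I_1 * 'I_d => `|w.1 i.1 i.2|) (0, a)).
Qed.

Lemma time_le_norm (w : spacetime) : `|w.2| <= `|w|.
Proof. by rewrite [leRHS]/Num.norm /= le_max lexx orbT. Qed.

(** The time coordinate attains a positive minimum on a non-empty compact [K], and [K] is bounded;
    [r] is the smaller of this minimum and the inverse of a bound. *)
Lemma subset_box (K : set spacetime) : compact K -> K `<=` pos ->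
  exists2 r, 0 < r & K `<=` box r.
Proof.
move=> cK Kpos; have [->|/set0P K0] := eqVneq K set0.
  by exists 1 => // z.
have [|c cK' cmin] := @compact_EVT_min spacetime R snd K K0 cK.
  by apply: continuous_subspaceT => z; exact: cvg_snd.
have c0 : 0 < c.2 by apply: Kpos; rewrite inE in cK'.
have [M [Mr HM]] := compact_bounded cK.
have M0 : 0 < Num.max 1 (M + 1) by rewrite lt_max ltr01.
pose r := Num.min c.2 (Num.max 1 (M + 1))^-1.
have r0 : 0 < r by rewrite lt_min c0 invr_gt0.
have rM : Num.max 1 (M + 1) <= r^-1.
  by rewrite -[leLHS]invrK lef_pV2 ?posrE ?invr_gt0 // ge_min lexx orbT.
exists r => // z Kz.
have zM : `|z| <= r^-1.
  apply: HM => //; apply: lt_le_trans rM.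
  by rewrite lt_max ltrDl ltr01 orbT.
split; first by move=> a; apply: le_trans zM; exact: coord_le_norm.
apply/andP; split; last first.
  by apply: le_trans zM; apply: le_trans (ler_norm _) _; exact: time_le_norm.
apply: (@le_trans _ _ c.2); first by rewrite ge_min lexx.
by apply: cmin; rewrite inE.
Qed.

(** The condition [r <= 1] ensures r^-1 + r / 2 <= 2 / r, so that halving the parameter leaves room
    on the outer sides as well as near time 0. *)
Lemma box_thicken r (z w : spacetime) : 0 < r -> r <= 1 -> box r z ->
  (forall a, `|w.1 0 a| <= r / 2) -> `|w.2| <= r / 2 -> box (r / 2) (z + w).
Proof.
move=> r0 r1 [z1 /andP[z2 z2']] w1 w2.
have rV : r^-1 + r / 2 <= (r / 2)^-1.
  have r1V : 1 <= r^-1 by rewrite -[leLHS]invr1 lef_pV2 ?posrE.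
  rewrite invfM invrK; lra.
split=> [a|]; rewrite /= ?mxE.
  by apply: le_trans rV; apply: le_trans (ler_normD _ _) (lerD (z1 a) (w1 a)).
move: w2; rewrite ler_norml => /andP[w2 w2'].
by apply/andP; split; [lra|apply: le_trans rV; lra].
Qed.

Lemma box_subset r r' : 0 < r' -> r' <= r -> box r `<=` box r'.
Proof.
move=> r0' rr' z [z1 /andP[z2 z3]].
have V : r^-1 <= r'^-1 by rewrite lef_pV2 ?posrE // (lt_le_trans r0').
split; first by move=> a; exact: le_trans (z1 a) V.
by rewrite (le_trans rr' z2) (le_trans z3 V).
Qed.

Definition bounded_boxes (p : nat) (F : R -> spacetime -> R) :=
  forall r, 0 < r -> exists C, \forall h \near 0^'+,
    forall z, box r z -> `|F h z| <= C * h ^+ p.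

Lemma bigO_fieldP p F : bigO_field p F <->
  (\forall h \near 0^'+, smooth_on pos (F h)) /\
  (forall s, bounded_boxes p (fun h => iter_derive s (F h))).
Proof.
split=> -[sF bF]; split => // s.
  by move=> r r0; apply: bF; [exact: compact_box|exact: box_positive].
move=> K cK Kp; have [r r0 Kr] := subset_box cK Kp.
have [C HC] := bF s r r0; exists C.
by apply: filterS HC => h Hh z /Kr; exact: Hh.
Qed.

Lemma bigO_smooth p F : bigO_field p F -> \forall h \near 0^'+, smooth_on pos (F h).
Proof. by case. Qed.

Lemma bigO_bounded p F : bigO_field p F -> bounded_boxes p F.
Proof. by move=> /bigO_fieldP[_ /(_ [::])]. Qed.

(* The families of fields are compared at small time steps and positive times,
   where the hypotheses control them. *)
Definition eq_fields (F G : R -> spacetime -> R) :=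
  \forall h \near 0^'+, eq_pos (F h) (G h).

Lemma eq_fields_sym F G : eq_fields F G -> eq_fields G F.
Proof. by apply: filterS => h FG z pz; rewrite FG. Qed.

Lemma bounded_boxes_ext p F G : eq_fields F G -> bounded_boxes p F -> bounded_boxes p G.
Proof.
move=> FG bF r r0; have [C HC] := bF r r0; exists C.
apply: filterS2 FG HC => h FG HC z bz; rewrite -FG; first exact: HC.
exact: box_positive bz.
Qed.

Lemma eq_fields_iter_derive s F G : eq_fields F G ->
  eq_fields (fun h => iter_derive s (F h)) (fun h => iter_derive s (G h)).
Proof. by apply: filterS => h; exact: eq_pos_iter_derive. Qed.

Lemma bigO_ext p F G : eq_fields F G -> bigO_field p F -> bigO_field p G.
Proof.
move=> FG /bigO_fieldP[sF bF]; apply/bigO_fieldP; split.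
  by apply: filterS2 FG sF => h; exact: smooth_eq_pos.
move=> s; apply: bounded_boxes_ext (bF s); exact: eq_fields_iter_derive.
Qed.

(** The analogue of [smooth_coind] for families: once the class is stable under derivation, a bound
    on the members, without derivatives, bounds all their derivatives at the same order [p]. *)
Lemma bigO_coind (C : (R -> spacetime -> R) -> Prop) p :
  (forall F, C F -> \forall h \near 0^'+, smooth_on pos (F h)) ->
  (forall F, C F -> bounded_boxes p F) ->
  (forall F v, C F -> exists2 G, C G & eq_fields (fun h => 'D_v (F h)) G) ->
  forall F, C F -> bigO_field p F.
Proof.
move=> Cs Cb CD F CF; apply/bigO_fieldP; split; first exact: Cs.
move=> s; suff [G CG FG] : exists2 G, C G & eq_fields (fun h => iter_derive s (F h)) G.
  by apply: bounded_boxes_ext (Cb G CG); exact: eq_fields_sym.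
elim: s => [|v s [G CG FG]]; first by exists F => //; near=> h.
have [H CH GH] := CD G v CG; exists H => //.
apply: filterS2 FG GH => h FG GH z pz.
by rewrite -GH //=; exact: eq_pos_derive.
Unshelve. all: by end_near. Qed.

Lemma bigO_derive p (F : R -> spacetime -> R) v :
  bigO_field p F -> bigO_field p (fun h => 'D_v (F h)).
Proof.
move=> /bigO_fieldP[sF bF]; apply/bigO_fieldP; split.
  by apply: filterS sF => h; exact: smooth_derive.
by move=> s; have := bF (rcons s v); under eq_fun do rewrite iter_derive_rcons.
Qed.

End Boxes.

(** * Stability of smooth functions under operations *)

Section SmoothClosure.
Context {R : realType} {d : nat}.
Local Notation spacetime := (spacetime R d).
Local Notation pos := (@positive_time R d).
Implicit Types (F G : spacetime -> R) (z v w : spacetime).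

Lemma smooth_derivable1 (g : R -> R) (x : R) : smooth g -> derivable g x 1.
Proof. by move=> /(_ 0%N x). Qed.

Lemma smooth_derive1 (g : R -> R) : smooth g -> smooth (derive1 g).
Proof. by move=> sg n x; have := sg n.+1 x; rewrite derive1Sn. Qed.

Lemma derive_add F G z v : differentiable F z -> differentiable G z ->
  'D_v (fun y => F y + G y) z = 'D_v F z + 'D_v G z.
Proof. by move=> dF dG; apply: deriveD; exact: diff_derivable. Qed.

Lemma derive_mul F G z v : differentiable F z -> differentiable G z ->
  'D_v (fun y => F y * G y) z = 'D_v F z * G z + F z * 'D_v G z.
Proof.
move=> dF dG; rewrite (@deriveM _ _ F G) /=; [|exact: diff_derivable..].
by rewrite addrC; congr (_ + _); exact: mulrC.
Qed.

Lemma derive_scale c F z v : differentiable F z ->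
  'D_v (fun y => c * F y) z = c * 'D_v F z.
Proof. by move=> dF; apply: (@deriveZ _ _ _ F); exact: diff_derivable. Qed.

(** Expressions built from smooth functions. The rules of differentiation turn each of them into
    another expression of the class, which is what [smooth_coind] asks for. *)
Inductive smooth_class : (spacetime -> R) -> Prop :=
| smooth_base F : smooth_on pos F -> smooth_class F
| smooth_const c : smooth_class (fun=> c)
| smooth_add F G : smooth_class F -> smooth_class G -> smooth_class (fun z => F z + G z)
| smooth_mul F G : smooth_class F -> smooth_class G -> smooth_class (fun z => F z * G z)
| smooth_comp g F : smooth g -> smooth_class F -> smooth_class (fun z => g (F z))
| smooth_inv F : (forall z, pos z -> F z != 0) -> smooth_class F ->
    smooth_class (fun z => (F z)^-1).

Lemma smooth_classP F : smooth_class F -> smooth_on pos F.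
Proof.
have dC G z : smooth_class G -> pos z -> differentiable G z.
  move=> CG pz; elim: CG => {G}.
  - by move=> G sG; exact: smooth_differentiable.
  - by move=> c; exact: differentiable_cst.
  - by move=> G H _ dG _ dH; exact: differentiableD.
  - by move=> G H _ dG _ dH; exact: differentiableM.
  - by move=> g G sg _ dG; apply: differentiable_comp1 => //; exact: smooth_derivable1.
  - by move=> G Gn _ dG; apply: differentiableV => //; exact: Gn.
apply: smooth_coind => // {}F v; elim => {F}.
- move=> F sF; exists ('D_v F) => //; constructor; exact: smooth_derive.
- move=> c; exists (fun=> 0); first exact: smooth_const.
  by move=> z _; exact: derive_cst.
- move=> F G CF [F' CF' FF'] CG [G' CG' GG'].
  exists (fun z => F' z + G' z); first exact: smooth_add.
  by move=> z pz; rewrite derive_add ?FF' ?GG' //; exact: dC.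
- move=> F G CF [F' CF' FF'] CG [G' CG' GG'].
  exists (fun z => F' z * G z + F z * G' z).
    by apply: smooth_add; apply: smooth_mul.
  by move=> z pz; rewrite derive_mul ?FF' ?GG' //; exact: dC.
- move=> g F sg CF [F' CF' FF'].
  exists (fun z => derive1 g (F z) * F' z).
    by apply: smooth_mul CF'; apply: (@smooth_comp (derive1 g)) CF; exact: smooth_derive1.
  move=> z pz; rewrite -FF' //; apply: derive_comp1; last exact: dC.
  exact: smooth_derivable1.
- move=> F Fn CF [F' CF' FF'].
  exists (fun z => (-1) * (F' z * (F z)^-1 * (F z)^-1)).
    apply: smooth_mul; first exact: smooth_const.
    by apply: smooth_mul; [apply: smooth_mul => //|]; apply: smooth_inv.
  by move=> z pz; rewrite derive_inv ?FF' ?mulN1r //; [exact: Fn|exact: dC].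
Qed.

Lemma smooth_translate F w : 0 <= w.2 -> smooth_on pos F ->
  smooth_on pos (fun z => F (z + w)).
Proof.
move=> w0 sF.
apply: (@smooth_coind _ _ (fun G => exists2 H, smooth_on pos H & G = fun z => H (z + w))).
- move=> G z [H sH ->] pz; apply: differentiable_translate.
  by apply: smooth_differentiable => //; rewrite /positive_time /= ltr_wpDr.
- move=> G v [H sH ->]; exists (fun z => 'D_v H (z + w)).
    by exists ('D_v H) => //; exact: smooth_derive.
  by move=> z _; exact: derive_translate.
- by exists F.
Qed.

End SmoothClosure.

(** * Stability of the orders O(h^p) under operations *)

Section FieldClosure.
Context {R : realType} {d : nat}.
Local Notation spacetime := (spacetime R d).
Local Notation pos := (@positive_time R d).
Implicit Types (F G : R -> spacetime -> R) (v w : spacetime).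

Lemma near0_gt0 : \forall h \near (0 : R)^'+, 0 < h.
Proof. exact: nbhs_right_gt. Qed.

Lemma near0_lt (e : R) : 0 < e -> \forall h \near (0 : R)^'+, h < e.
Proof. exact: nbhs_right_lt. Qed.

Lemma smooth_bounded_comp (g : R -> R) (C : R) : smooth g ->
  exists D, forall x, `|x| <= C -> `|g x| <= D.
Proof.
move=> sg.
have cg : compact (g @` `[- C, C]%classic).
  apply: continuous_compact; last exact: segment_compact.
  apply: derivable_within_continuous => x _; exact: smooth_derivable1.
have [M [Mr HM]] := compact_bounded cg.
exists (M + 1) => x xC; apply: (HM (M + 1)); first by rewrite ltrDl.
by exists x => //=; rewrite in_itv /= -ler_norml.
Qed.

(** The graded version of [smooth_class]: the index is the order in h, additive under products. For
    an inverse, non-vanishing alone would allow values tending to 0 with h, hence the lower bound on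
    each box, uniform in h. *)
Inductive field_class : nat -> (R -> spacetime -> R) -> Prop :=
| field_base p F : bigO_field p F -> field_class p F
| field_const (c : R) : field_class 0 (fun _ _ => c)
| field_step : field_class 1 (fun h _ => h)
| field_add p F G : field_class p F -> field_class p G ->
    field_class p (fun h z => F h z + G h z)
| field_mul p p' F G : field_class p F -> field_class p' G ->
    field_class (p + p') (fun h z => F h z * G h z)
| field_comp g F : smooth g -> field_class 0 F -> field_class 0 (fun h z => g (F h z))
| field_inv F : (\forall h \near 0^'+, forall z, pos z -> F h z != 0) ->
    (forall r, 0 < r -> exists2 c, 0 < c & \forall h \near 0^'+,
       forall z, box r z -> c <= `|F h z|) ->
    field_class 0 F -> field_class 0 (fun h z => (F h z)^-1).

Lemma field_class_smooth p F : field_class p F ->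
  \forall h \near 0^'+, smooth_class (F h).
Proof.
elim=> {p F}.
- by move=> p F [sF _]; apply: filterS sF => h; exact: smooth_base.
- by move=> c; near=> h; exact: smooth_const.
- by near=> h; exact: smooth_const.
- by move=> p F G _ sF _ sG; apply: filterS2 sF sG => h; exact: smooth_add.
- by move=> p p' F G _ sF _ sG; apply: filterS2 sF sG => h; exact: smooth_mul.
- by move=> g F sg _ sF; apply: filterS sF => h; exact: smooth_comp.
- by move=> F Fn _ _ sF; apply: filterS2 Fn sF => h; exact: smooth_inv.
Unshelve. all: by end_near. Qed.

Lemma field_class_bounded p F : field_class p F -> bounded_boxes p F.
Proof.
elim=> {p F}.
- by move=> p F; exact: bigO_bounded.
- by move=> c r r0; exists `|c|; near=> h => z _; rewrite expr0 mulr1.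
- move=> r r0; exists 1; apply: filterS near0_gt0 => h h0 z _.
  by rewrite mul1r expr1 gtr0_norm.
- move=> p F G _ bF _ bG r r0; have [C HC] := bF r r0; have [D HD] := bG r r0.
  exists (C + D); apply: filterS2 HC HD => h HC HD z bz.
  by rewrite mulrDl (le_trans (ler_normD _ _)) // lerD ?HC ?HD.
- move=> p p' F G _ bF _ bG r r0; have [C HC] := bF r r0; have [D HD] := bG r r0.
  exists (C * D); apply: filterS2 HC HD => h HC HD z bz.
  by rewrite normrM exprD mulrACA ler_pM // ?HC ?HD.
- move=> g F sg _ bF r r0; have [C HC] := bF r r0.
  have [D HD] := smooth_bounded_comp C sg.
  exists D; apply: filterS HC => h HC z bz.
  by rewrite expr0 mulr1; apply: HD; have := HC z bz; rewrite expr0 mulr1.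
- move=> F _ lF _ _ r r0; have [c c0 Hc] := lF r r0.
  exists c^-1; apply: filterS Hc => h Hc z bz.
  have cF := Hc z bz.
  by rewrite expr0 mulr1 normfV lef_pV2 ?posrE // (lt_le_trans c0 cF).
Unshelve. all: by end_near. Qed.

Lemma field_classP p F : field_class p F -> bigO_field p F.
Proof.
apply: bigO_coind => {F}.
- by move=> F /field_class_smooth; apply: filterS => h; exact: smooth_classP.
- exact: field_class_bounded.
have dC p' F : field_class p' F ->
    \forall h \near 0^'+, forall z, pos z -> differentiable (F h) z.
  move=> /field_class_smooth; apply: filterS => h /smooth_classP sF z pz.
  exact: smooth_differentiable.
move=> F v; elim => {p F}.
- move=> p F bF; exists (fun h => 'D_v (F h)); last by near=> h.
  by apply: field_base; exact: bigO_derive.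
- move=> c; exists (fun _ _ => 0); first exact: field_const.
  by near=> h => z _; exact: derive_cst.
(* The derivative of the step is zero, but it has to be exhibited as a member of the class at order
   1. *)
- exists (fun h _ => h * 0).
    exact: (@field_mul 1 0 _ _ field_step (field_const 0)).
  by near=> h => z _; rewrite mulr0; exact: derive_cst.
- move=> p F G CF [F' CF' FF'] CG [G' CG' GG'].
  exists (fun h z => F' h z + G' h z); first exact: field_add.
  apply: filterS3 (filterI (dC _ _ CF) (dC _ _ CG)) FF' GG' => h [dF dG] FF' GG' z pz.
  by rewrite derive_add ?FF' ?GG' //; [exact: dF|exact: dG].
- move=> p p' F G CF [F' CF' FF'] CG [G' CG' GG'].
  exists (fun h z => F' h z * G h z + F h z * G' h z).
    by apply: field_add; apply: field_mul.
  apply: filterS3 (filterI (dC _ _ CF) (dC _ _ CG)) FF' GG' => h [dF dG] FF' GG' z pz.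
  by rewrite derive_mul ?FF' ?GG' //; [exact: dF|exact: dG].
- move=> g F sg CF [F' CF' FF'].
  exists (fun h z => derive1 g (F h z) * F' h z).
    apply: (@field_mul 0 0 (fun h z => derive1 g (F h z))) CF'.
    by apply: (@field_comp (derive1 g)) CF; exact: smooth_derive1.
  apply: filterS2 (dC _ _ CF) FF' => h dF FF' z pz.
  rewrite -FF' //; apply: derive_comp1; last exact: dF.
  exact: smooth_derivable1.
- move=> F Fn lF CF [F' CF' FF'].
  exists (fun h z => (-1) * (F' h z * (F h z)^-1 * (F h z)^-1)).
    apply: (@field_mul 0 0); first exact: field_const.
    have CV := field_inv Fn lF CF.
    by apply: (@field_mul 0 0) => //; apply: (@field_mul 0 0).
  apply: filterS3 (dC _ _ CF) FF' Fn => h dF FF' Fn z pz.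
  by rewrite derive_inv ?FF' ?mulN1r //; [exact: Fn|exact: dF].
Unshelve. all: by end_near. Qed.

Lemma bigO_const (c : R) : bigO_field 0 (fun _ (_ : spacetime) => c).
Proof. by apply: field_classP; exact: field_const. Qed.

Lemma bigO_add p F G : bigO_field p F -> bigO_field p G ->
  bigO_field p (fun h z => F h z + G h z).
Proof. by move=> bF bG; apply: field_classP; apply: field_add; exact: field_base. Qed.

Lemma bigO_mul p p' F G : bigO_field p F -> bigO_field p' G ->
  bigO_field (p + p') (fun h z => F h z * G h z).
Proof. by move=> bF bG; apply: field_classP; apply: field_mul; exact: field_base. Qed.

Lemma bigO_mul0l p F G : bigO_field 0 F -> bigO_field p G ->
  bigO_field p (fun h z => F h z * G h z).
Proof. by move=> bF bG; exact: (bigO_mul bF bG). Qed.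

Lemma bigO_scale p (c : R) F : bigO_field p F ->
  bigO_field p (fun h z => c * F h z).
Proof. by apply: bigO_mul0l; exact: bigO_const. Qed.

Lemma bigO_opp p F : bigO_field p F -> bigO_field p (fun h z => - F h z).
Proof.
move=> /(@bigO_scale p (-1)); apply: bigO_ext; near=> h => z _.
by rewrite mulN1r.
Unshelve. all: by end_near. Qed.

Lemma bigO_sub p F G : bigO_field p F -> bigO_field p G ->
  bigO_field p (fun h z => F h z - G h z).
Proof. by move=> bF bG; apply: bigO_add => //; exact: bigO_opp. Qed.

Lemma bigO_stepX p (k : nat) F : bigO_field p F ->
  bigO_field (k + p) (fun h z => h ^+ k * F h z).
Proof.
move=> bF; apply: field_classP; apply: field_mul; last exact: field_base.
elim: k => [|k IH]; first exact: field_const.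
under eq_fun do under eq_fun do rewrite exprS.
exact: (@field_mul 1 k _ _ field_step IH).
Qed.

Lemma bigO_comp g F : smooth g -> bigO_field 0 F -> bigO_field 0 (fun h z => g (F h z)).
Proof. by move=> sg bF; apply: field_classP; apply: field_comp => //; exact: field_base. Qed.

Lemma bigO_inv F : (\forall h \near 0^'+, forall z, pos z -> F h z != 0) ->
    (forall r, 0 < r -> exists2 c, 0 < c & \forall h \near 0^'+,
       forall z, box r z -> c <= `|F h z|) ->
  bigO_field 0 F -> bigO_field 0 (fun h z => (F h z)^-1).
Proof. by move=> Fn lF bF; apply: field_classP; apply: field_inv => //; exact: field_base. Qed.

Lemma bigO_zero p : bigO_field p (fun _ (_ : spacetime) => 0).
Proof.
have := @bigO_stepX 0 p _ (bigO_const 0); rewrite addn0; apply: bigO_ext.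
by near=> h => z _; rewrite mulr0.
Unshelve. all: by end_near. Qed.

Lemma bigO_sum p (I : Type) (r : seq I) (Q : pred I) (F : I -> R -> spacetime -> R) :
  (forall i, Q i -> bigO_field p (F i)) ->
  bigO_field p (fun h z => \sum_(i <- r | Q i) F i h z).
Proof.
move=> bF; elim: r => [|i r IH].
  apply: bigO_ext (bigO_zero p); near=> h => z _.
  by rewrite big_nil.
have [Qi|Qi] := boolP (Q i).
  apply: bigO_ext (bigO_add (bF i Qi) IH); near=> h => z _.
  by rewrite big_cons Qi.
apply: bigO_ext IH; near=> h => z _.
by rewrite big_cons (negbTE Qi).
Unshelve. all: by end_near. Qed.

Lemma bigO_prod (I : Type) (r : seq I) (Q : pred I) (F : I -> R -> spacetime -> R) :
  (forall i, Q i -> bigO_field 0 (F i)) ->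
  bigO_field 0 (fun h z => \prod_(i <- r | Q i) F i h z).
Proof.
move=> bF; elim: r => [|i r IH].
  apply: bigO_ext (bigO_const 1); near=> h => z _.
  by rewrite big_nil.
have [Qi|Qi] := boolP (Q i).
  apply: bigO_ext (bigO_mul0l (bF i Qi) IH); near=> h => z _.
  by rewrite big_cons Qi.
apply: bigO_ext IH; near=> h => z _.
by rewrite big_cons (negbTE Qi).
Unshelve. all: by end_near. Qed.

Lemma bigO_exp (k : nat) F : bigO_field 0 F -> bigO_field 0 (fun h z => F h z ^+ k).
Proof.
move=> bF; elim: k => [|k IH].
  by apply: bigO_ext (bigO_const 1); near=> h => z _; rewrite expr0.
by apply: bigO_ext (bigO_mul0l bF IH); near=> h => z _; rewrite exprS.
Unshelve. all: by end_near. Qed.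

Lemma bigO_le p p' F : (p <= p')%N -> bigO_field p' F -> bigO_field p F.
Proof.
move=> pp' /bigO_fieldP[sF bF]; apply/bigO_fieldP; split => // s r r0.
(* Comparing the powers of h requires a nonnegative constant, and the sign of [C] is unknown. *)
have [C HC] := bF s r r0; exists `|C|.
apply: filterS3 HC near0_gt0 (near0_lt ltr01) => h HC h0 h1 z bz.
apply: le_trans (HC z bz) _.
apply: (@le_trans _ _ (`|C| * h ^+ p')).
  by rewrite ler_wpM2r ?ler_norm // exprn_ge0 // ltW.
rewrite ler_wpM2l // -(subnK pp') exprD ler_piMl //.
  by rewrite exprn_ge0 // ltW.
by rewrite exprn_ile1 // ltW.
Qed.

(** The factor h^-k is unbounded as h tends to 0, so the product rule for orders does not apply; but
    it is constant in [z], hence commutes with all derivatives and divides each bound. *)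
Lemma bigO_divX p k F : bigO_field (k + p) F -> bigO_field p (fun h z => h ^- k * F h z).
Proof.
move=> bF; move/bigO_fieldP: (bF) => [sF _]; apply/bigO_fieldP.
have sm (G : spacetime -> R) c : smooth_on pos G -> smooth_on pos (fun z => c * G z).
  by move=> sG; apply: smooth_classP; apply: smooth_mul; [exact: smooth_const|exact: smooth_base].
split; first by apply: filterS sF => h; exact: sm.
have it s (G : spacetime -> R) c : smooth_on pos G ->
    eq_pos (iter_derive s (fun z => c * G z)) (fun z => c * iter_derive s G z).
  elim/last_ind: s G => [//|s v IH] G sG z pz; rewrite !iter_derive_rcons.
  rewrite -IH //; last exact: smooth_derive.
  apply: eq_pos_iter_derive => // y py.
  by rewrite derive_scale //; exact: smooth_differentiable.
move=> s r r0.
move/bigO_fieldP: bF => [_ /(_ s r r0)[C HC]]; exists C.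
apply: filterS3 HC sF near0_gt0 => h HC sF h0 z bz.
rewrite it //; last exact: box_positive bz.
have hk : 0 < h ^+ k by rewrite exprn_gt0.
rewrite normrM normfV (gtr0_norm hk) ler_pdivrMl // mulrCA -exprD; exact: HC.
Qed.

End FieldClosure.

(** * Taylor's formula *)

Section Sums.
Context {R : realType} {V : normedModType R}.

Lemma differentiable_bigsum (I : Type) (r : seq I) (Q : pred I) (F : I -> V -> R) z :
  (forall i, differentiable (F i) z) ->
  differentiable (fun y => \sum_(i <- r | Q i) F i y) z.
Proof.
move=> dF; elim: r => [|i r IH].
  have -> : (fun y => \sum_(i <- [::] | Q i) F i y) = cst 0.
    by apply/funext => y; rewrite big_nil.
  exact: differentiable_cst.
have [Qi|Qi] := boolP (Q i).
  have -> : (fun y => \sum_(j <- i :: r | Q j) F j y)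
      = F i + (fun y => \sum_(j <- r | Q j) F j y).
    by apply/funext => y; rewrite big_cons Qi.
  exact: differentiableD.
by have -> // : (fun y => \sum_(j <- i :: r | Q j) F j y)
      = (fun y => \sum_(j <- r | Q j) F j y);
  apply/funext => y; rewrite big_cons (negbTE Qi).
Qed.

Lemma derive_bigsum (I : Type) (r : seq I) (Q : pred I) (F : I -> V -> R) z v :
  (forall i, differentiable (F i) z) ->
  'D_v (fun y => \sum_(i <- r | Q i) F i y) z = \sum_(i <- r | Q i) 'D_v (F i) z.
Proof.
move=> dF; elim: r => [|i r IH].
  have -> : (fun y => \sum_(i <- [::] | Q i) F i y) = cst 0.
    by apply/funext => y; rewrite big_nil.
  by rewrite big_nil derive_cst.
rewrite big_cons -IH; have [Qi|Qi] := boolP (Q i).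
  have -> : (fun y => \sum_(j <- i :: r | Q j) F j y)
      = F i + (fun y => \sum_(j <- r | Q j) F j y).
    by apply/funext => y; rewrite big_cons Qi.
  rewrite deriveD //; apply: diff_derivable; [exact: dF|exact: differentiable_bigsum].
have -> // : (fun y => \sum_(j <- i :: r | Q j) F j y)
      = (fun y => \sum_(j <- r | Q j) F j y).
by apply/funext => y; rewrite big_cons (negbTE Qi).
Qed.

End Sums.

Section Taylor.
Context {R : realType} {d : nat}.
Local Notation spacetime := (spacetime R d).
Local Notation pos := (@positive_time R d).
Implicit Types (F G : spacetime -> R) (v w z : spacetime).

Lemma iter_derive_comm s v F : smooth_on pos F ->
  eq_pos ('D_v (iter_derive s F)) (iter_derive s ('D_v F)).
Proof.
elim: s => [//|u s IH] sF z pz /=.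
rewrite (smooth_derive_comm _ _ (smooth_iter_derive s sF)) //.
by apply: eq_pos_derive => //; exact: IH.
Qed.

Lemma iter_derive_nseqS k w F :
  iter_derive (nseq k.+1 w) F = iter_derive (nseq k w) ('D_w F).
Proof. by elim: k => [//|k IH]; rewrite -[nseq k.+2 w]/(w :: nseq k.+1 w) /= -IH. Qed.

Lemma is_derive_poly_sum N (a : 'I_N -> R) (t : R) :
  is_derive t 1 (fun r => \sum_(k < N) r ^+ k.+1 / k.+1`!%:R * a k)
    (\sum_(k < N) t ^+ k / k`!%:R * a k).
Proof.
have -> : (fun r => \sum_(k < N) r ^+ k.+1 / k.+1`!%:R * a k)
   = \sum_(k < N) (fun r => r ^+ k.+1 / k.+1`!%:R * a k).
  by apply/funext => r; rewrite fct_sumE.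
apply: is_derive_sum => k.
have H : is_derive t 1 (fun r : R => (k.+1`!%:R^-1 * a k) * r ^+ k.+1)
    ((k.+1`!%:R^-1 * a k) * (k.+1%:R * t ^+ k)).
  have dX : derivable (fun r : R => r ^+ k.+1) t 1 by exact: exprn_derivable.
  split; first exact: (@derivableZ _ _ _ (fun r : R => r ^+ k.+1)).
  rewrite (@deriveZ _ _ _ (fun r : R => r ^+ k.+1)) // exp_derive.
  by rewrite /GRing.scale /= mulr1.
have -> : (fun r : R => r ^+ k.+1 / k.+1`!%:R * a k)
   = (fun r : R => (k.+1`!%:R^-1 * a k) * r ^+ k.+1).
  by apply/funext => r; rewrite mulrC mulrCA mulrC -mulrA [a k * _]mulrC mulrCA mulrC; ring.
suff -> : t ^+ k / k`!%:R * a k = (k.+1`!%:R^-1 * a k) * (k.+1%:R * t ^+ k) by [].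
have f0 : (k`!%:R : R) != 0 by rewrite pnatr_eq0 -lt0n fact_gt0.
have k0 : (k.+1%:R : R) != 0 by rewrite pnatr_eq0.
rewrite factS natrM; move: (k.+1%:R : R) (k`!%:R : R) k0 f0 => x y x0 y0.
by field; rewrite x0 y0.
Qed.

(** Induction on [N] through the mean value theorem: the derivative in [t] of the remainder of order
    N + 1 of [F] is the remainder of order N of ['D_w F]. The mean value theorem loses the factor 1
    / N!, which is irrelevant for orders in h. *)
Lemma taylor_bound N F z w (T C : R) : 0 <= T -> smooth_on pos F ->
  (forall t, 0 <= t <= T -> pos (z + t *: w)) ->
  (forall t, 0 <= t <= T -> `|iter_derive (nseq N w) F (z + t *: w)| <= C) ->
  `|F (z + T *: w) - \sum_(k < N) T ^+ k / k`!%:R * iter_derive (nseq k w) F z|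
    <= C * T ^+ N.
Proof.
elim: N F T => [|N IH] F T T0 sF pF bF.
  rewrite big_ord0 subr0 expr0 mulr1.
  by apply: (bF T); rewrite T0 lexx.
pose c (k : 'I_N) := iter_derive (nseq k w) ('D_w F) z.
pose phi t := F (z + t *: w) - \sum_(k < N) t ^+ k.+1 / k.+1`!%:R * c k.
pose dphi t := 'D_w F (z + t *: w) - \sum_(k < N) t ^+ k / k`!%:R * c k.
have dl t : 0 <= t <= T -> is_derive t 1 phi (dphi t).
  move=> tT; rewrite /phi /dphi.
  have H1 : is_derive t 1 (fun r : R => F (z + r *: w)) ('D_w F (z + t *: w)).
    by apply: is_derive_line; apply: smooth_derivable => //; exact: pF.
  exact: (@is_deriveB _ _ _ (fun r : R => F (z + r *: w)) _ t 1 _ _ H1 (is_derive_poly_sum c t)).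
have [||t tT E] := @MVT_segment R phi dphi 0 T T0.
- by move=> t; rewrite in_itv /= => /andP[t0 tT]; apply: dl; rewrite !ltW.
- apply: derivable_within_continuous => t; rewrite in_itv /= => tT.
  by have [] := dl t tT.
rewrite in_itv /= in tT; have /andP[t0 tT'] := tT.
have -> : F (z + T *: w) - \sum_(k < N.+1) T ^+ k / k`!%:R * iter_derive (nseq k w) F z
    = phi T - phi 0.
  rewrite /phi scale0r addr0 big_ord_recl /= expr0 fact0 divr1 mul1r.
  rewrite [X in _ = _ - (_ - X)]big1; last by move=> k _; rewrite expr0n /= !mul0r.
  rewrite subr0 opprD addrA addrAC; congr (_ - _ - _).
  apply: eq_bigr => k _; rewrite /c; congr (_ * _).
  by rewrite -iter_derive_nseqS.
rewrite E subr0 normrM exprSr mulrA [X in _ * X]ger0_norm // ler_wpM2r //.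
apply: le_trans (_ : C * t ^+ N <= _).
  apply: IH => //; first exact: smooth_derive.
    by move=> r /andP[r0 rt]; apply: pF; rewrite r0 (le_trans rt).
  move=> r /andP[r0 rt]; rewrite -iter_derive_nseqS.
  by apply: bF; rewrite r0 (le_trans rt).
have C0 : 0 <= C by apply: le_trans (bF 0 _); rewrite ?normr_ge0 // lexx.
by rewrite ler_wpM2l // lerXn2r // nnegrE.
Qed.

End Taylor.

Section FieldTaylor.
Context {R : realType} {d : nat}.
Local Notation spacetime := (spacetime R d).
Local Notation pos := (@positive_time R d).
Implicit Types (F G : R -> spacetime -> R) (v w : spacetime).

Lemma box_segment w (r : R) : 0 < r -> r <= 1 -> \forall h \near 0^'+,
  forall z t, box r z -> 0 <= t <= h -> box (r / 2) (z + t *: w).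
Proof.
move=> r0 r1; have N0 : 0 < `|w| + 1 by rewrite ltr_wpDl.
have e0 : 0 < r / 2 / (`|w| + 1) by rewrite !divr_gt0.
apply: filterS2 near0_gt0 (near0_lt e0) => h h0 he z t bz /andP[t0 th].
have tw : t * `|w| <= r / 2.
  apply: (@le_trans _ _ (h * (`|w| + 1))).
    by apply: ler_pM => //; rewrite lerDl.
  by rewrite -ler_pdivlMr // ltW.
apply: box_thicken => //= [a|].
  by rewrite mxE normrM ger0_norm //; apply: le_trans tw; rewrite ler_wpM2l // coord_le_norm.
by rewrite normrM ger0_norm //; apply: le_trans tw; rewrite ler_wpM2l // time_le_norm.
Qed.

(** Translates of O(h^p) families form a class stable under derivation, and for small h a translated
    box stays in a slightly larger box. The condition on [w.2] keeps times positive. *)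
Lemma bigO_translate p w F : 0 <= w.2 -> bigO_field p F ->
  bigO_field p (fun h z => F h (z + h *: w)).
Proof.
move=> w0 bF.
apply: (@bigO_coind _ _ (fun G => exists2 H, bigO_field p H & G = fun h z => H h (z + h *: w))).
- move=> G [H [sH _] ->]; apply: filterS2 near0_gt0 sH => h h0; apply: smooth_translate.
  by rewrite /= mulr_ge0 // ltW.
- move=> G [H bH ->] r r0.
  (* The parameter is capped at 1 because thickening a box requires it; the box of [r] lies in the
     box of the capped parameter. *)
  have m0 : 0 < Num.min r 1 by rewrite lt_min r0 ltr01.
  have m1 : Num.min r 1 <= 1 by rewrite ge_min lexx orbT.
  have m2 : 0 < Num.min r 1 / 2 by rewrite divr_gt0.
  have [C HC] := bigO_bounded bH m2; exists C.
  apply: filterS3 HC (box_segment w m0 m1) near0_gt0 => h HC Hb h0 z bz.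
  apply/HC/Hb; last by rewrite lexx ltW.
  by apply: box_subset bz => //; rewrite ge_min lexx.
- move=> G v [H bH ->]; exists (fun h z => 'D_v (H h) (z + h *: w)).
    by exists (fun h => 'D_v (H h)) => //; exact: bigO_derive.
  by near=> h => z _; exact: derive_translate.
- by exists F.
Unshelve. all: by end_near. Qed.

Lemma bigO_iter_derive p s F : bigO_field p F -> bigO_field p (fun h => iter_derive s (F h)).
Proof. by move=> bF; elim: s => [//|v s IH] /=; exact: bigO_derive. Qed.

Definition taylor_rest N w F h z :=
  F h (z + h *: w) - \sum_(k < N) h ^+ k / k`!%:R * iter_derive (nseq k w) (F h) z.

(** By the symmetry of second derivatives, the derivative of a Taylor rest is the Taylor rest of the
    derivative. The rests thus form a class stable under derivation, and [taylor_bound] supplies the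
    bound on its members. *)
Lemma bigO_taylor_rest N p w F : 0 <= w.2 -> bigO_field p F ->
  bigO_field (N + p) (taylor_rest N w F).
Proof.
move=> w0 bF.
apply: (@bigO_coind _ _ (fun G => exists2 H, bigO_field p H & G = taylor_rest N w H)).
- move=> G [H bH ->]; apply: (@bigO_smooth _ _ p).
  apply: bigO_sub; first exact: bigO_translate.
  apply: bigO_sum => k _.
  apply: (@bigO_le _ _ _ (k + p)); first exact: leq_addl.
  apply: bigO_ext (bigO_stepX k (bigO_scale k`!%:R^-1 (bigO_iter_derive (nseq k w) bH))).
  by near=> h => z _; rewrite mulrA.
- move=> G [H bH ->] r r0.
  have m0 : 0 < Num.min r 1 by rewrite lt_min r0 ltr01.
  have m1 : Num.min r 1 <= 1 by rewrite ge_min lexx orbT.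
  have m2 : 0 < Num.min r 1 / 2 by rewrite divr_gt0.
  have [C HC] := bigO_bounded (bigO_iter_derive (nseq N w) bH) m2; exists C.
  apply: filterS3 (filterI (bigO_smooth bH) HC) (box_segment w m0 m1) near0_gt0.
  move=> h [sH HC'] Hb h0 z bz.
  have bt t : 0 <= t <= h -> box (Num.min r 1 / 2) (z + t *: w).
    by move=> th; apply: Hb => //; apply: box_subset bz => //; rewrite ge_min lexx.
  rewrite addnC exprD mulrA; apply: taylor_bound => //.
  + exact: ltW.
  + by move=> t /bt; exact: box_positive.
  + by move=> t /bt; exact: HC'.
- move=> G v [H bH ->]; exists (taylor_rest N w (fun h => 'D_v (H h))).
    by exists (fun h => 'D_v (H h)) => //; exact: bigO_derive.
  apply: filterS2 (bigO_smooth bH) near0_gt0 => h sH h0 z pz; rewrite /taylor_rest.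
  have pzw : pos (z + h *: w) by rewrite /positive_time /= ltr_wpDr // mulr_ge0 // ltW.
  have dk k : differentiable (fun y => h ^+ k / k`!%:R * iter_derive (nseq k w) (H h) y) z.
    apply: (@differentiableZ _ _ _ (iter_derive (nseq k w) (H h))); exact: sH.
  rewrite (@deriveB _ _ _ (fun y => H h (y + h *: w))
     (fun y => \sum_(k < N) h ^+ k / k`!%:R * iter_derive (nseq k w) (H h) y)); first last.
  + by apply: diff_derivable; apply: differentiable_bigsum => k; exact: dk.
  + by apply: diff_derivable; apply: differentiable_translate; exact: smooth_differentiable.
  rewrite derive_translate derive_bigsum; last by move=> k; exact: dk.
  congr (_ - _); apply: eq_bigr => k _.
  rewrite derive_scale; last exact: sH.
  by rewrite iter_derive_comm.
- by exists F.
Unshelve. all: by end_near. Qed.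

End FieldTaylor.

(** * Fields vanishing on the lattice *)

Section Grid.
Context {R : realType} {d : nat}.
Local Notation spacetime := (spacetime R d).
Local Notation pos := (@positive_time R d).
Implicit Types (F G : R -> spacetime -> R) (v w z : spacetime).

Lemma basis_decomposition w :
  w = w.2 *: ((0, 1) : spacetime)
      + \sum_a w.1 0 a *: ((delta_mx 0 a, 0) : spacetime).
Proof.
have fs (f : 'I_d -> spacetime) : (\sum_a f a).1 = \sum_a (f a).1.
  exact: (big_morph fst (fun _ _ => erefl) erefl).
have ss (f : 'I_d -> spacetime) : (\sum_a f a).2 = \sum_a (f a).2.
  exact: (big_morph snd (fun _ _ => erefl) erefl).
case: w => x t; congr (_, _).
  by rewrite fs /= scaler0 add0r; exact: row_sum_delta.
rewrite ss /= [t *: 1]mulr1 big1 ?addr0 // => a _; exact: mulr0.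
Qed.

Lemma derive_basis (F : spacetime -> R) w z : differentiable F z ->
  'D_w F z = w.2 * partial_t F z + \sum_a w.1 0 a * partial_x a F z.
Proof.
move=> dF; rewrite {1}(basis_decomposition w) derive_dirD // derive_dirZ //.
congr (_ + _); rewrite derive_dir_sum //.
by apply: eq_bigr => a _; rewrite derive_dirZ.
Qed.

Lemma iter_derive_lin s (c1 c2 : R) (F G : spacetime -> R) :
  smooth_on pos F -> smooth_on pos G ->
  eq_pos (iter_derive s (fun z => c1 * F z + c2 * G z))
         (fun z => c1 * iter_derive s F z + c2 * iter_derive s G z).
Proof.
elim/last_ind: s F G => [//|s v IH] F G sF sG z pz.
rewrite !iter_derive_rcons -IH //; [|exact: smooth_derive..].
apply: eq_pos_iter_derive => // y py.
have dF := smooth_differentiable sF py; have dG := smooth_differentiable sG py.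
rewrite derive_add; [|exact: (@differentiableZ _ _ _ F)|exact: (@differentiableZ _ _ _ G)].
by rewrite !derive_scale.
Qed.

(** [bigO_field] bounds all derivatives at once; this isolates one sequence [s], so that an
    induction on [s] becomes possible in [vanishing_step]. *)
Definition bounded_derivative s p F := bounded_boxes p (fun h => iter_derive s (F h)).

Lemma bounded_derivative_lin s p (c1 c2 : R) F G :
  (\forall h \near 0^'+, smooth_on pos (F h)) -> (\forall h \near 0^'+, smooth_on pos (G h)) ->
  bounded_derivative s p F -> bounded_derivative s p G ->
  bounded_derivative s p (fun h z => c1 * F h z + c2 * G h z).
Proof.
move=> sF sG bF bG r r0; have [C HC] := bF r r0; have [D HD] := bG r r0.
exists (`|c1| * C + `|c2| * D).
apply: filterS3 (filterI HC HD) sF sG => h [HC' HD'] sF sG z bz.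
rewrite iter_derive_lin //; last exact: box_positive bz.
apply: le_trans (ler_normD _ _) _; rewrite !normrM mulrDl -!mulrA.
by rewrite lerD // ler_wpM2l // ?HC' ?HD'.
Qed.

Lemma bounded_derivative_sum s p (c : 'I_d -> R) (F : 'I_d -> R -> spacetime -> R) :
  (forall a, \forall h \near 0^'+, smooth_on pos (F a h)) ->
  (forall a, bounded_derivative s p (F a)) ->
  bounded_derivative s p (fun h z => \sum_a c a * F a h z).
Proof.
move=> sF bF.
have sS (r : seq 'I_d) :
    \forall h \near 0^'+, smooth_on pos (fun z => \sum_(a <- r) c a * F a h z).
  have sF' : \forall h \near 0^'+, forall a, smooth_on pos (F a h) by exact: filter_forall.
  apply: filterS sF' => h sF'; apply: smooth_classP.
  elim: r => [|a r IH].
    under eq_fun do rewrite big_nil.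
    exact: smooth_const.
  under eq_fun do rewrite big_cons.
  apply: smooth_add IH; apply: smooth_mul; [exact: smooth_const|exact: smooth_base].
elim: (index_enum 'I_d) => [|a r IH].
  have [_ H] := iffLR (bigO_fieldP p _) (@bigO_zero R d p).
  apply: bounded_boxes_ext (H s); near=> h => z pz.
  by under [in RHS]eq_fun do rewrite big_nil.
have := bounded_derivative_lin (c a) 1 (sF a) (sS r) (bF a) IH.
apply: bounded_boxes_ext; near=> h => z pz.
by under [in RHS]eq_fun do rewrite big_cons -[X in _ + X]mul1r.
Unshelve. all: by end_near. Qed.

Variables (lambda : R) (origin : R -> 'rV[R]_d).
Hypothesis lambda_gt0 : 0 < lambda.

Definition grid (h : R) : set spacetime :=
  [set z | cartesian_lattice (origin h) (lambda * h) z.1 /\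
           exists2 n : nat, (0 < n)%N & z.2 = n%:R * h].

Definition vanishes_on_grid F := \forall h \near 0^'+, forall z, grid h z -> F h z = 0.

Lemma grid_space_shift h a z : grid h z ->
  grid h (z + h *: ((lambda *: delta_mx 0 a, 0) : spacetime)).
Proof.
move=> [[n En] [k k0 Ek]]; split; last by exists k => //=; rewrite scaler0 addr0.
exists (n + delta_mx 0 a); rewrite /= En -addrA; congr (_ + _).
rewrite map_mxD scalerDr map_delta_mx; congr (_ + _).
by rewrite scalerA mulrC.
Qed.

Lemma grid_time_shift h z : grid h z -> grid h (z + h *: ((0, 1) : spacetime)).
Proof.
move=> [Lz [k k0 Ek]]; split; first by rewrite /= scaler0 addr0.
by exists k.+1 => //=; rewrite [h *: 1]mulr1 Ek -natr1 mulrDl mul1r.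
Qed.

(** The grid point is obtained by rounding down each coordinate. The error is a multiple of h, with
    a factor [w] bounded independently of h and [z]. Assuming [h <= z.2] makes the rounded time
    positive. *)
Lemma grid_near h z : 0 < h -> h <= z.2 -> exists w,
  [/\ grid h (z - h *: w), (forall a, `|w.1 0 a| <= lambda) & `|w.2| <= 1].
Proof.
move=> h0 hz; have lh0 : 0 < lambda * h by rewrite mulr_gt0.
pose n : 'rV[int]_d := \row_a Num.floor ((z.1 0 a - origin h 0 a) / (lambda * h)).
pose k := Num.truncn (z.2 / h).
have zh : 0 <= z.2 / h by rewrite divr_ge0 // ltW // (lt_le_trans h0).
have /andP[k1 k2] := truncn_itv zh.
pose g : spacetime := (origin h + lambda * h *: map_mx intr n, k%:R * h).
have k0 : (0 < k)%N.
  have : 1 < k.+1%:R :> R by apply: le_lt_trans k2; rewrite ler_pdivlMr // mul1r.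
  by rewrite ltr1n.
exists (h^-1 *: (z - g)); split.
- rewrite scalerA divff ?gt_eqF // scale1r opprB addrCA subrr addr0; split.
    by exists n.
  by exists k.
- move=> a; rewrite /= !mxE.
  set x := z.1 0 a - origin h 0 a.
  have -> : z.1 0 a - (origin h 0 a + lambda * h * (Num.floor (x / (lambda * h)))%:~R)
     = lambda * h * (x / (lambda * h) - (Num.floor (x / (lambda * h)))%:~R).
    by rewrite mulrBr [_ * (x / _)]mulrC divfK ?gt_eqF // /x; ring.
  have f1 := ge_floor (x / (lambda * h)); have f2 := lt_succ_floor (x / (lambda * h)).
  move: f1 f2; set y := x / _; set m := (Num.floor y)%:~R => f1 f2.
  have -> : h^-1 * (lambda * h * (y - m)) = lambda * (y - m).
    by rewrite mulrA mulrCA mulVf ?gt_eqF // mulr1.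
  rewrite normrM gtr0_norm // ger_pMr // ger0_norm; last by rewrite subr_ge0.
  by rewrite lerBlDl; apply/ltW; move: f2; rewrite intrD.
- rewrite /=; have -> : h^-1 *: (z.2 - k%:R * h) = z.2 / h - k%:R.
    by rewrite /GRing.scale /= mulrBr mulrC [h^-1 * (_ * h)]mulrCA mulVf ?gt_eqF // mulr1.
  rewrite ger0_norm ?subr_ge0 // lerBlDl; apply/ltW.
  by rewrite natr1.
Qed.

(** A zero of [F h] lies within O(h) of every point of a box, and the first derivatives are O(h^p);
    the mean value theorem gains one power of h. *)
Lemma vanishing_bound p F : bigO_field p F -> vanishes_on_grid F -> bounded_boxes p.+1 F.
Proof.
move=> bF vF r r0.
have m0 : 0 < Num.min r 1 by rewrite lt_min r0 ltr01.
have m1 : Num.min r 1 <= 1 by rewrite ge_min lexx orbT.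
set m := Num.min r 1 in m0 m1.
have m2 : 0 < m / 2 by rewrite divr_gt0.
have [Ct HCt] := bigO_bounded (bigO_derive ((0, 1) : spacetime) bF) m2.
have /choice[Cx HCx] : forall a, exists C, \forall h \near 0^'+,
    forall z, box (m / 2) z -> `|partial_x a (F h) z| <= C * h ^+ p.
  by move=> a; exact: (bigO_bounded (bigO_derive ((delta_mx 0 a, 0) : spacetime) bF) m2).
have HCx' : \forall h \near 0^'+, forall a z, box (m / 2) z ->
    `|partial_x a (F h) z| <= Cx a * h ^+ p by exact: filter_forall.
pose L := Num.max lambda 1.
have L0 : 0 < L by rewrite lt_max lambda_gt0.
exists (L * (Ct + \sum_a Cx a)).
(* Coordinates move by at most h L along the segment to the grid point; for h below this bound the
   segment stays in the thickened box. *)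
have mL : 0 < m / 2 / L by rewrite !divr_gt0.
apply: filterS3 (filterI near0_gt0 (filterI (near0_lt m0) (near0_lt mL)))
  (filterI HCt HCx') (filterI vF (bigO_smooth bF)).
move=> h [h0 [hm hmL]] [HCt' HCx''] [vF' sF] z bz.
have bz' : box m z by apply: box_subset bz => //; rewrite ge_min lexx.
have hz : h <= z.2 by have [_ /andP[mz _]] := bz'; apply: le_trans mz; exact: ltW.
have [w [gw w1 w2]] := grid_near h0 hz.
have w1L a : `|w.1 0 a| <= L by apply: le_trans (w1 a) _; rewrite le_max lexx.
have w2L : `|w.2| <= L by apply: le_trans w2 _; rewrite le_max lexx orbT.
have bt t : 0 <= t <= h -> box (m / 2) (z - h *: w + t *: w).
  move=> /andP[t0 th].
  have -> : z - h *: w + t *: w = z + (t - h) *: w by rewrite -addrA scalerBl [- _ + _]addrC.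
  have tL (x : R) : `|x| <= L -> `|(t - h) * x| <= m / 2.
    move=> xL; have ht : 0 <= h - t by rewrite subr_ge0.
    have ht' : h - t <= h by rewrite lerBlDr lerDl.
    rewrite normrM -normrN opprB (ger0_norm ht).
    apply: (@le_trans _ _ (h * L)).
      exact: ler_pM.
    by rewrite -ler_pdivlMr // ltW.
  by apply: box_thicken => // [a|]; rewrite /= ?mxE; exact: tL.
have [|t th E] := @mvt_line _ _ (F h) (z - h *: w) w h (ltW h0).
  move=> t /bt bt'; apply: smooth_differentiable => //; exact: box_positive bt'.
have -> : F h z = h * 'D_w (F h) (z - h *: w + t *: w).
  by rewrite -E (vF' _ gw) subr0 subrK.
have btt := bt t th.
rewrite normrM gtr0_norm // exprS mulrCA ler_pM2l //.
rewrite derive_basis; last by apply: smooth_differentiable => //; exact: box_positive btt.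
apply: le_trans (ler_normD _ _) _.
rewrite -mulrA mulrDl mulrDr lerD //.
  by rewrite normrM ler_pM //; exact: HCt'.
apply: le_trans (ler_norm_sum _ _ _) _.
rewrite mulr_suml mulr_sumr ler_sum // => a _.
by rewrite normrM ler_pM //; exact: HCx''.
Qed.

(** Along a period of the grid the difference quotient again vanishes on the grid. It is h^-1 times
    the first-order Taylor rest, hence regular with all its derivatives. *)
Lemma vanishing_difference w F : 0 <= w.2 ->
  (forall h z, grid h z -> grid h (z + h *: w)) ->
  bigO_field 0 F -> vanishes_on_grid F ->
  let G h z := h^-1 * (F h (z + h *: w) - F h z) in
  bigO_field 0 G /\ vanishes_on_grid G.
Proof.
move=> w0 gw bF vF; split.
  have b1 := bigO_taylor_rest 1 w0 bF.
  apply: bigO_ext (@bigO_divX _ _ 0 1 _ b1); near=> h => z _.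
  by rewrite /taylor_rest big_ord1 expr0 fact0 divr1 mul1r expr1.
apply: filterS vF => h vF z gz; rewrite !vF ?subrr ?mulr0 //; exact: gw.
Unshelve. all: by end_near. Qed.

(** The inner induction is on the sequence of derivatives, for all [F] simultaneously. The innermost
    derivative is a difference quotient, to which the induction hypothesis applies, minus h^-1 times
    a second-order Taylor rest. *)
Lemma vanishing_step p :
  (forall F, bigO_field 0 F -> vanishes_on_grid F -> bigO_field p F) ->
  forall F, bigO_field 0 F -> vanishes_on_grid F -> bigO_field p.+1 F.
Proof.
move=> Hp F bF vF; apply/bigO_fieldP; split; first exact: bigO_smooth bF.
move=> s; rewrite -/(bounded_derivative s p.+1 F).
elim/last_ind: s F bF vF => [|s v IH] F bF vF.
  by apply: vanishing_bound => //; exact: Hp.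
have dir w : 0 <= w.2 -> (forall h z, grid h z -> grid h (z + h *: w)) ->
    bounded_derivative s p.+1 (fun h => 'D_w (F h)).
  move=> w0 gw; have [bG vG] := vanishing_difference w0 gw bF vF.
  (* As [F] is already O(h^p), the rest is O(h^(p+2)); dividing it by h still leaves one order more
     than p. *)
  have bT := @bigO_divX _ _ p.+1 1 _ (bigO_taylor_rest 2 w0 (Hp F bF vF)).
  have [_ /(_ s) bT'] := iffLR (bigO_fieldP _ _) bT.
  have := bounded_derivative_lin 1 (-1) (bigO_smooth bG) (bigO_smooth bT) (IH _ bG vG) bT'.
  apply: bounded_boxes_ext; apply: eq_fields_iter_derive.
  apply: filterS near0_gt0 => h h0 z pz.
  rewrite /taylor_rest big_ord_recr big_ord1 /= expr0 fact0 divr1 expr1 factS fact0 muln1 divr1.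
  move: (F h (z + h *: w)) (F h z) ('D_w (F h) z) => x y c.
  by field; rewrite gt_eqF.
suff H : bounded_derivative s p.+1 (fun h => 'D_v (F h)).
  by rewrite /bounded_derivative; under eq_fun do rewrite iter_derive_rcons.
(* An arbitrary direction [v] need not be a period of the grid, and it may point backwards in time.
   Its derivative is recombined linearly from those along the unit time vector and the [e a], which
   are periods. *)
pose e a : spacetime := (lambda *: delta_mx 0 a, 0).
have sD w : \forall h \near 0^'+, smooth_on pos ('D_w (F h)).
  exact: bigO_smooth (bigO_derive w bF).
have bt : bounded_derivative s p.+1 (fun h => partial_t (F h)).
  exact: (dir ((0, 1) : spacetime) ler01 (@grid_time_shift)).
have bx a := dir (e a) (lexx 0) (fun h z => @grid_space_shift h a z).
have bS := bounded_derivative_sum (fun a => v.1 0 a / lambda) (fun a => sD (e a)) bx.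
have sS : \forall h \near 0^'+, smooth_on pos (fun z => \sum_a v.1 0 a / lambda * 'D_(e a) (F h) z).
  apply: (@bigO_smooth _ _ 0); apply: bigO_sum => a _.
  by apply: bigO_scale; exact: bigO_derive.
have := bounded_derivative_lin v.2 1 (sD _) sS bt bS.
apply: bounded_boxes_ext; apply: eq_fields_iter_derive.
apply: filterS (bigO_smooth bF) => h sF z pz.
have dF := smooth_differentiable sF pz.
have Es : \sum_a v.1 0 a / lambda * 'D_(e a) (F h) z = \sum_a v.1 0 a * partial_x a (F h) z.
  apply: eq_bigr => a _.
  have -> : e a = lambda *: ((delta_mx 0 a, 0) : spacetime).
    by congr (_, _); rewrite scaler0.
  by rewrite derive_dirZ // mulrA divfK // gt_eqF.
rewrite mul1r.
rewrite Es.
apply: esym.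
exact: (derive_basis v dF).
Qed.

(* The derivative along a period of the grid is, up to a Taylor rest, a
   difference quotient, which vanishes on the grid as well: each order of
   vanishing thus propagates to all the derivatives. *)
Lemma bigO_vanishing p F : bigO_field 0 F -> vanishes_on_grid F -> bigO_field p F.
Proof.
elim: p F => [//|p IH] F bF vF; exact: vanishing_step.
Qed.

End Grid.

(** * Regularity of the matrix of moments *)

Section Continuity.
Context {R : realType} {T : topologicalType}.

Lemma continuous_bigsum (I : Type) (r : seq I) (Q : pred I) (F : I -> T -> R) :
  (forall i, continuous (F i)) -> continuous (fun x => \sum_(i <- r | Q i) F i x).
Proof.
move=> cF x; elim: r => [|i r IH].
  by under eq_fun do rewrite big_nil; exact: cvg_cst.
under eq_fun do rewrite big_cons.
case: (Q i); last exact: IH.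
apply: cvgD IH; exact: cF.
Qed.

Lemma continuous_bigprod (I : Type) (r : seq I) (Q : pred I) (F : I -> T -> R) :
  (forall i, continuous (F i)) -> continuous (fun x => \prod_(i <- r | Q i) F i x).
Proof.
move=> cF x; elim: r => [|i r IH].
  by under eq_fun do rewrite big_nil; exact: cvg_cst.
under eq_fun do rewrite big_cons.
case: (Q i); last exact: IH.
apply: cvgM IH; exact: cF.
Qed.

Lemma continuous_expr (k : nat) (F : T -> R) :
  continuous F -> continuous (fun x => F x ^+ k).
Proof.
move=> cF x; elim: k => [|k IH]; first by under eq_fun do rewrite expr0; exact: cvg_cst.
under eq_fun do rewrite exprS.
apply: cvgM IH; exact: cF.
Qed.

Lemma continuous_scale (c : R) (F : T -> R) :
  continuous F -> continuous (fun x => c * F x).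
Proof. by move=> cF x; apply: cvgM; [exact: cvg_cst|exact: cF]. Qed.

Lemma continuous_meval d (p : mpoly d R) (F : T -> 'I_d -> R) :
  (forall a, continuous (F ^~ a)) -> continuous (fun x => meval (F x) p).
Proof.
move=> cF; under eq_fun do rewrite mevalE.
apply: continuous_bigsum => m; apply: continuous_scale.
by apply: continuous_bigprod => a; apply: continuous_expr; exact: cF.
Qed.

Lemma continuous_det n (A : T -> 'M[R]_n) :
  (forall i j, continuous (fun x => A x i j)) -> continuous (fun x => \det (A x)).
Proof.
move=> cA; apply: continuous_bigsum => s; apply: continuous_scale.
by apply: continuous_bigprod => i; exact: cA.
Qed.

End Continuity.

Section RegularMatrix.
Context {R : realType} {d : nat}.
Local Notation spacetime := (spacetime R d).
Local Notation pos := (@positive_time R d).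

Lemma bigO_meval (p : mpoly d R) (F : 'I_d -> R -> spacetime -> R) :
  (forall a, bigO_field 0 (F a)) ->
  bigO_field 0 (fun h z => meval (fun a => F a h z) p).
Proof.
move=> bF; under eq_fun do under eq_fun do rewrite mevalE.
apply: bigO_sum => m _; apply: bigO_scale.
by apply: bigO_prod => a _; exact: bigO_exp.
Qed.

Lemma bigO_det n (A : R -> spacetime -> 'M[R]_n) :
  (forall i j, bigO_field 0 (fun h z => A h z i j)) ->
  bigO_field 0 (fun h z => \det (A h z)).
Proof.
move=> bA; apply: bigO_sum => s _; apply: bigO_scale.
by apply: bigO_prod => i _; exact: bA.
Qed.

(** Cramer's formula: the entries of the inverse are polynomials in those of [A], divided by the
    determinant, whose uniform lower bound controls the quotient. *)
Lemma bigO_invmx n (A : R -> spacetime -> 'M[R]_n) :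
  (forall h z, A h z \in unitmx) ->
  (forall r, 0 < r -> exists2 c, 0 < c & \forall h \near 0^'+,
     forall z, box r z -> c <= `|\det (A h z)|) ->
  (forall i j, bigO_field 0 (fun h z => A h z i j)) ->
  forall i j, bigO_field 0 (fun h z => invmx (A h z) i j).
Proof.
move=> uA lA bA i j.
have bD : bigO_field 0 (fun h z => (\det (A h z))^-1).
  apply: bigO_inv => //; last exact: bigO_det.
  by near=> h => z _; have := uA h z; rewrite unitmxE unitfE.
have bC : bigO_field 0 (fun h z => \det (row' j (col' i (A h z)))).
  apply: bigO_det => k l; apply: bigO_ext (bA (lift j k) (lift i l)).
  by near=> h => z _; rewrite !mxE.
apply: bigO_ext (bigO_mul0l bD (bigO_scale ((-1) ^+ (j + i)) bC)).
by near=> h => z _; rewrite /invmx uA !mxE /cofactor.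
Unshelve. all: by end_near. Qed.

Variables (q : nat) (P : 'I_q -> mpoly d R) (v : 'I_q -> 'rV[R]_d).
Variable (ut : R -> spacetime -> 'rV[R]_d).
Hypothesis M_invertible : forall u : 'rV[R]_d, moment_matrix P v u \in unitmx.
Hypothesis ut_regular : forall a : 'I_d, regular_field (fun h z => ut h z 0 a).

Lemma moment_matrix_regular k j :
  bigO_field 0 (fun h z => moment_matrix P v (ut h z) k j).
Proof.
under eq_fun do under eq_fun do rewrite mxE.
apply: (@bigO_meval (P k) (fun a h z => (v j - ut h z) 0 a)) => a.
apply: bigO_ext (bigO_sub (bigO_const (v j 0 a)) (ut_regular a)).
by near=> h => z _; rewrite !mxE.
Unshelve. all: by end_near. Qed.

Lemma moment_matrix_continuous k j : continuous (fun u => moment_matrix P v u k j).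
Proof.
have -> : (fun u => moment_matrix P v u k j) = (fun u => meval (fun a => (v j - u) 0 a) (P k)).
  by apply/funext => u; rewrite mxE.
apply: (@continuous_meval R 'rV[R]_d d (P k) (fun u a => (v j - u) 0 a)) => a.
have -> : (fun u => (v j - u) 0 a) = (fun u : 'rV[R]_d => v j 0 a - u 0 a).
  by apply/funext => u; rewrite !mxE.
move=> u; apply: (@continuousB _ _ _ (cst (v j 0 a)) (fun u : 'rV[R]_d => u 0 a)).
  exact: cst_continuous.
exact: coord_continuous.
Qed.

(** On a box the values of [ut h] stay in a cube independent of small h. The continuous function
    |det M(u)| vanishes nowhere and attains a positive minimum on this compact cube. *)
Lemma det_moment_matrix_bound r : 0 < r -> exists2 c, 0 < c &
  \forall h \near 0^'+, forall z, box r z -> c <= `|\det (moment_matrix P v (ut h z))|.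
Proof.
move=> r0.
have /choice[C HC] : forall a, exists C, \forall h \near 0^'+,
    forall z, box r z -> `|ut h z 0 a| <= C * h ^+ 0.
  by move=> a; exact: (bigO_bounded (ut_regular a)).
have HC' : \forall h \near 0^'+, forall a z, box r z -> `|ut h z 0 a| <= C a * h ^+ 0.
  exact: filter_forall.
pose D := \sum_a `|C a|.
pose K := [set u : 'rV[R]_d | forall a, `[- D, D]%classic (u ord0 a)].
have cK : compact K.
  by apply: (@rV_compact R d (fun=> `[- D, D]%classic)) => a; exact: segment_compact.
have D0 : 0 <= D by rewrite sumr_ge0.
have K0 : K !=set0.
  by exists 0 => a /=; rewrite mxE in_itv /= oppr_le0 D0.
have cdet : continuous (fun u => `|\det (moment_matrix P v u)|).
  move=> u; apply: (@continuous_comp _ _ _ (fun u => \det (moment_matrix P v u)) Num.norm).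
    by apply: continuous_det => i j; exact: moment_matrix_continuous.
  exact: norm_continuous.
have [c _ Hc] := EVT_min_rV K0 cK (continuous_subspaceT cdet).
exists `|\det (moment_matrix P v c)|.
  by rewrite normr_gt0 -unitfE -unitmxE.
apply: filterS HC' => h HC' z bz; apply: Hc; rewrite inE => a /=.
rewrite in_itv /= -ler_norml; apply: le_trans (HC' a z bz) _.
rewrite expr0 mulr1 /D (bigD1 a) //=; apply: le_trans (ler_norm _) _.
by rewrite lerDl sumr_ge0.
Qed.

Lemma invmx_moment_matrix_regular j l :
  bigO_field 0 (fun h z => invmx (moment_matrix P v (ut h z)) j l).
Proof.
apply: bigO_invmx => //; first exact: det_moment_matrix_bound.
exact: moment_matrix_regular.
Qed.

End RegularMatrix.

(** * The third-order expansion *)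

Section Congruence.
Context {R : realType} {d : nat}.
Local Notation spacetime := (spacetime R d).
Local Notation pos := (@positive_time R d).
Local Notation field := (R -> spacetime -> R).
Implicit Types (F G H : field).

Lemma eqO_refl p F : equal_mod_bigO p F F.
Proof. by apply: bigO_ext (bigO_zero p); near=> h => z _; rewrite subrr.
Unshelve. all: by end_near. Qed.

Lemma eq_fields_eqO p F G : eq_fields F G -> equal_mod_bigO p F G.
Proof.
move=> FG; apply: bigO_ext (bigO_zero p); apply: filterS FG => h FG z pz.
by rewrite FG ?subrr.
Qed.

Lemma eqO_sym p F G : equal_mod_bigO p F G -> equal_mod_bigO p G F.
Proof.
by move/bigO_opp; apply: bigO_ext; near=> h => z _; rewrite opprB.
Unshelve. all: by end_near. Qed.

Lemma eqO_trans p G F H :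
  equal_mod_bigO p F G -> equal_mod_bigO p G H -> equal_mod_bigO p F H.
Proof.
move=> FG GH; apply: bigO_ext (bigO_add FG GH); near=> h => z _.
by rewrite addrA subrK.
Unshelve. all: by end_near. Qed.

Lemma eqO_le p p' F G : (p <= p')%N -> equal_mod_bigO p' F G -> equal_mod_bigO p F G.
Proof. exact: bigO_le. Qed.

Lemma eqO_add p F G F' G' : equal_mod_bigO p F G -> equal_mod_bigO p F' G' ->
  equal_mod_bigO p (fun h z => F h z + F' h z) (fun h z => G h z + G' h z).
Proof.
move=> FG FG'; apply: bigO_ext (bigO_add FG FG'); near=> h => z _.
by rewrite opprD addrACA.
Unshelve. all: by end_near. Qed.

Lemma eqO_opp p F G : equal_mod_bigO p F G ->
  equal_mod_bigO p (fun h z => - F h z) (fun h z => - G h z).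
Proof.
by move/bigO_opp; apply: bigO_ext; near=> h => z _; rewrite opprD.
Unshelve. all: by end_near. Qed.

Lemma eqO_sub p F G F' G' : equal_mod_bigO p F G -> equal_mod_bigO p F' G' ->
  equal_mod_bigO p (fun h z => F h z - F' h z) (fun h z => G h z - G' h z).
Proof. by move=> FG FG'; apply: eqO_add => //; exact: eqO_opp. Qed.

Lemma eqO_mull p K F G : bigO_field 0 K -> equal_mod_bigO p F G ->
  equal_mod_bigO p (fun h z => K h z * F h z) (fun h z => K h z * G h z).
Proof.
move=> bK FG; apply: bigO_ext (bigO_mul0l bK FG); near=> h => z _.
by rewrite mulrBr.
Unshelve. all: by end_near. Qed.

Lemma eqO_scale p (c : R) F G : equal_mod_bigO p F G ->
  equal_mod_bigO p (fun h z => c * F h z) (fun h z => c * G h z).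
Proof. by apply: eqO_mull; exact: bigO_const. Qed.

(** The prefactor h^k raises the precision by k, so a term of higher degree in h may be replaced by
    a cruder approximation. The shape of the prefactor is that of the terms in the expansion of the
    jump. *)
Lemma eqO_step (c : R) k p F G : equal_mod_bigO p F G ->
  equal_mod_bigO (k + p) (fun h z => h ^+ k * c * F h z) (fun h z => h ^+ k * c * G h z).
Proof.
move=> /(eqO_scale c) /(bigO_stepX k); apply: bigO_ext; near=> h => z _.
by rewrite mulrBr !mulrA.
Unshelve. all: by end_near. Qed.

Lemma eqO_sum p (I : Type) (r : seq I) (Q : pred I) (F G : I -> field) :
  (forall i, Q i -> equal_mod_bigO p (F i) (G i)) ->
  equal_mod_bigO p (fun h z => \sum_(i <- r | Q i) F i h z)
    (fun h z => \sum_(i <- r | Q i) G i h z).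
Proof.
move=> FG; apply: bigO_ext (bigO_sum _ FG); near=> h => z _.
by rewrite sumrB.
Unshelve. all: by end_near. Qed.

Lemma eqO_derive p v F G : bigO_field 0 F -> bigO_field 0 G ->
  equal_mod_bigO p F G -> equal_mod_bigO p (fun h => 'D_v (F h)) (fun h => 'D_v (G h)).
Proof.
move=> bF bG /(bigO_derive v); apply: bigO_ext.
apply: filterS2 (bigO_smooth bF) (bigO_smooth bG) => h sF sG z pz.
by apply: deriveB; exact: smooth_derivable.
Qed.

End Congruence.

(** * Expansion derived from abstract moment identities *)

Section Expansion.
Context {R : realType} {d q : nat}.
Local Notation spacetime := (spacetime R d).
Local Notation pos := (@positive_time R d).
Local Notation field := (R -> spacetime -> R).
Variable v : 'I_q -> 'rV[R]_d.
Implicit Types (F G H : field) (X Y : 'I_q -> field) (c : 'I_q -> R).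

Definition dt F : field := fun h => partial_t (F h).
Definition dx b F : field := fun h => partial_x b (F h).
(** A diagonal operator: component j is derived along its own velocity. Writing the particular
    derivative as one derivative in the direction (v_j, 1) makes Taylor's formula directly
    applicable. *)
Definition transport X (j : 'I_q) : field := fun h => 'D_((v j, 1) : spacetime) (X j h).
Definition wsum c X : field := fun h z => \sum_j c j * X j h z.
Definition regular X := forall j, bigO_field 0 (X j).

Lemma dt_regular p F : bigO_field p F -> bigO_field p (dt F).
Proof. exact: bigO_derive. Qed.

Lemma dx_regular p b F : bigO_field p F -> bigO_field p (dx b F).
Proof. exact: bigO_derive. Qed.

Lemma transport_regular X : regular X -> regular (transport X).
Proof. by move=> rX j; exact: bigO_derive. Qed.

Lemma wsum_regular c X : regular X -> bigO_field 0 (wsum c X).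
Proof. by move=> rX; apply: bigO_sum => j _; apply: bigO_scale; exact: rX. Qed.

Lemma eqO_wsum p c X Y : (forall j, equal_mod_bigO p (X j) (Y j)) ->
  equal_mod_bigO p (wsum c X) (wsum c Y).
Proof. by move=> XY; apply: eqO_sum => j _; exact: eqO_scale. Qed.

Lemma regular_differentiable X : regular X -> \forall h \near 0^'+,
  forall z, pos z -> forall j, differentiable (X j h) z.
Proof.
move=> rX.
have sX : \forall h \near 0^'+, forall j, smooth_on pos (X j h).
  by apply: filter_forall => j; exact: (bigO_smooth (rX j)).
by apply: filterS sX => h sX z pz j; exact: smooth_differentiable.
Qed.

Lemma derive_wsum w c (g : 'I_q -> spacetime -> R) z :
  (forall j, differentiable (g j) z) ->
  'D_w (fun y => \sum_j c j * g j y) z = \sum_j c j * 'D_w (g j) z.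
Proof.
move=> dg; rewrite derive_bigsum.
  by apply: eq_bigr => j _; rewrite derive_scale.
by move=> j; exact: (@differentiableZ _ _ _ (g j)).
Qed.

(** The moment hierarchy: each space derivative in the transport of a moment brings one more factor
    v_j, so moments one degree higher appear under the divergence. *)
Lemma wsum_transport c X : regular X -> eq_fields (wsum c (transport X))
  (fun h z => dt (wsum c X) h z + \sum_b dx b (wsum (fun j => c j * v j 0 b) X) h z).
Proof.
move=> /regular_differentiable; apply: filterS => h dX z pz.
have {}dX := dX z pz.
rewrite /dt /partial_t derive_wsum // /dx /partial_x.
under [X in _ = _ + X]eq_bigr => b _ do rewrite derive_wsum //.
rewrite exchange_big -big_split /=; apply: eq_bigr => j _.
rewrite /transport derive_basis // /= mul1r mulrDr; congr (_ + _).
by rewrite mulr_sumr; apply: eq_bigr => b _; rewrite mulrA.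
Qed.

Definition total X := wsum (fun=> 1) X.
Definition momentum b X := wsum (fun j => v j 0 b) X.

Lemma total_transport X : regular X -> eq_fields (total (transport X))
  (fun h z => dt (total X) h z + \sum_b dx b (momentum b X) h z).
Proof.
move=> rX; have := wsum_transport (fun=> 1) rX.
have E b : (fun j : 'I_q => 1 * v j 0 b) = (fun j => v j 0 b).
  by apply/funext => j; rewrite mul1r.
by apply: filterS => h H z pz; rewrite [LHS]H //; congr (_ + _); apply: eq_bigr => b _; rewrite E.
Qed.

(** The shape of the second-order expansion of f, stable under derivation: deriving it amounts to
    deriving the three coefficients. *)
Definition combination F G H : field := fun h z => F h z - h * G h z - h / 2 * H h z.

Lemma combination_regular F G H : bigO_field 0 F -> bigO_field 0 G -> bigO_field 0 H ->
  bigO_field 0 (combination F G H).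
Proof.
move=> bF bG bH; apply: bigO_sub; first apply: bigO_sub => //.
  by apply: (@bigO_le _ _ _ 1) => //; exact: (bigO_stepX 1 bG).
apply: (@bigO_le _ _ _ 1) => //; apply: bigO_ext (bigO_stepX 1 (bigO_scale 2^-1 bH)).
by near=> h => z _; rewrite mulrA.
Unshelve. all: by end_near. Qed.

Lemma eqO_derive_combination p w F0 F G H :
  bigO_field 0 F0 -> bigO_field 0 F -> bigO_field 0 G -> bigO_field 0 H ->
  equal_mod_bigO p F0 (combination F G H) ->
  equal_mod_bigO p (fun h => 'D_w (F0 h))
    (combination (fun h => 'D_w (F h)) (fun h => 'D_w (G h)) (fun h => 'D_w (H h))).
Proof.
move=> b0 bF bG bH /(eqO_derive w b0 (combination_regular bF bG bH)).
move=> H1; apply: eqO_trans H1 _; apply: eq_fields_eqO.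
apply: filterS3 (bigO_smooth bF) (bigO_smooth bG) (bigO_smooth bH) => h sF sG sH z pz.
have dF := smooth_differentiable sF pz; have dG := smooth_differentiable sG pz.
have dH := smooth_differentiable sH pz.
have E : combination F G H h = (fun y => F h y + ((- h) * G h y + (- (h / 2)) * H h y)).
  by apply/funext => y; rewrite /combination !mulNr -addrA.
have dhG : differentiable (fun y => (- h) * G h y) z by exact: (@differentiableZ _ _ _ (G h)).
have dhH : differentiable (fun y => (- (h / 2)) * H h y) z by exact: (@differentiableZ _ _ _ (H h)).
rewrite E derive_add //; last exact: (differentiableD dhG dhH).
by rewrite derive_add // !derive_scale // !mulNr addrA.
Qed.

(* [f] are the distributions, [e] their equilibria, [A] the jumps f^* - f of the
   relaxation and [sinv b] is 1 / s_b. The expansion is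
   f = e - h T - h / 2 D e + O(h^2), where T_j = sum_(l >= 1) sigma_l M^-1_jl theta_l.
   [K] is M^-1 diag(0, 1 / s_1, ...) M and [N] the column 0 of M^-1. *)
Variables (f e T A : 'I_q -> field) (K : 'I_q -> 'I_q -> field) (N : 'I_q -> field).
Variables (u : 'I_d -> field) (sinv : 'I_d -> R).
Hypotheses (rf : regular f) (re : regular e) (rT : regular T) (rA : regular A).
Hypotheses (rK : forall j i, bigO_field 0 (K j i)) (rN : regular N).
Hypothesis ru : forall b, bigO_field 0 (u b).
Let D := transport.
Let sig b := sinv b - 2^-1.
Let theta b := momentum b (D e).
Let theta0 := total (D e).
(** The facts about the scheme on which the expansion rests. [hK] inverts the relaxation off the
    density row. In [hKT], the identity 1 / s_l = sigma_l + 1 / 2 yields [T] plus half the identity,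
    from which the density row, absent from [K], is removed. In [hmomT], the momentum rows of M(u)
    are v_b - u_b, hence the correction u_b theta_0. *)
Hypothesis hA : forall j, equal_mod_bigO 4 (A j) (fun h z =>
  h ^+ 1 * 1 * D f j h z + h ^+ 2 * 2^-1 * D (D f) j h z
  + h ^+ 3 * 6^-1 * D (D (D f)) j h z).
Hypothesis hmassA : eq_fields (total A) (fun _ _ => 0).
Hypothesis hK : forall j, eq_fields (fun h z => e j h z - f j h z)
  (fun h z => \sum_i K j i h z * A i h z).
Hypothesis hmomA : forall b, eq_fields (momentum b f)
  (fun h z => momentum b e h z - sinv b * momentum b A h z).
Hypothesis hKT : forall j, eq_fields (fun h z => \sum_i K j i h z * D e i h z)
  (fun h z => T j h z + 2^-1 * D e j h z - 2^-1 * (N j h z * theta0 h z)).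
Hypothesis hmassT : eq_fields (total T) (fun _ _ => 0).
Hypothesis hmomT : forall b, eq_fields (momentum b T)
  (fun h z => sig b * (theta b h z - u b h z * theta0 h z)).

Let rDf := transport_regular rf.
Let rDDf := transport_regular rDf.
Let rDDDf := transport_regular rDDf.
Let rDe := transport_regular re.
Let rDDe := transport_regular rDe.
Let rDT := transport_regular rT.

Lemma eqO_small k p (c : R) F : (p <= k)%N -> bigO_field 0 F ->
  equal_mod_bigO p (fun h z => h ^+ k * c * F h z) (fun _ _ => 0).
Proof.
move=> pk bF; have := bigO_stepX k (bigO_scale c bF); rewrite addn0 => bkF.
apply: bigO_le pk _; apply: bigO_ext bkF; near=> h => z _.
by rewrite subr0 mulrA.
Unshelve. all: by end_near. Qed.

Lemma jump_first : forall j, equal_mod_bigO 1 (A j) (fun _ _ => 0).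
Proof.
move=> j; apply: eqO_trans (eqO_le _ (hA j)) _ => //.
have := eqO_add (eqO_add (eqO_small 1 (leqnn 1) (rDf j)) (eqO_small 2^-1 (leqnSn 1) (rDDf j)))
   (eqO_small 6^-1 (isT : (1 <= 3)%N) (rDDDf j)).
by move/eqO_trans; apply; apply: eq_fields_eqO; near=> h => z _; rewrite !addr0.
Unshelve. all: by end_near. Qed.

Lemma equilibrium_first j : equal_mod_bigO 1 (f j) (e j).
Proof.
apply: eqO_sym; have H : equal_mod_bigO 1 (fun h z => e j h z - f j h z) (fun _ _ => 0).
  apply: eqO_trans (eq_fields_eqO _ (hK j)) _.
  have := @eqO_sum R d 1 _ (index_enum 'I_q) xpredT (fun i h z => K j i h z * A i h z)
    (fun i h z => K j i h z * 0) (fun i _ => eqO_mull (rK j i) (jump_first i)).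
  move/eqO_trans; apply; apply: eq_fields_eqO; near=> h => z _.
  by rewrite big1 // => i _; rewrite mulr0.
by apply: bigO_ext H; near=> h => z _; rewrite subr0.
Unshelve. all: by end_near. Qed.

Lemma transport_first j : equal_mod_bigO 1 (D f j) (D e j).
Proof. exact: (eqO_derive _ (rf j) (re j) (equilibrium_first j)). Qed.

Lemma jump_second j : equal_mod_bigO 2 (A j) (fun h z => h ^+ 1 * 1 * D e j h z).
Proof.
apply: eqO_trans (eqO_le _ (hA j)) _ => //.
have := eqO_add (eqO_add (eqO_step 1 1 (transport_first j)) (eqO_small 2^-1 (leqnn 2) (rDDf j)))
   (eqO_small 6^-1 (isT : (2 <= 3)%N) (rDDDf j)).
by move/eqO_trans; apply; apply: eq_fields_eqO; near=> h => z _; rewrite !addr0.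
Unshelve. all: by end_near. Qed.

Lemma wsumZ c (a : R -> R) X : wsum c (fun j h z => a h * X j h z) = fun h z => a h * wsum c X h z.
Proof.
apply/funext => h; apply/funext => z; rewrite /wsum mulr_sumr.
by apply: eq_bigr => j _; exact: mulrCA.
Qed.

Lemma eqO_div k p F G :
  equal_mod_bigO (k + p) (fun h z => h ^+ k * F h z) (fun h z => h ^+ k * G h z) ->
  equal_mod_bigO p F G.
Proof.
move=> /bigO_divX; apply: bigO_ext; apply: filterS near0_gt0 => h h0 z _.
by rewrite -mulrBr mulKf // expf_neq0 // gt_eqF.
Qed.

(** The density row of [jump_second] reads 0 = h theta_0 + O(h^2): the conservation equation at
    first order. *)
Lemma theta0_first : equal_mod_bigO 1 theta0 (fun _ _ => 0).
Proof.
have H := eqO_trans (eqO_sym (eq_fields_eqO 2 hmassA)) (eqO_wsum (fun=> 1) jump_second).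
rewrite (wsumZ (fun=> 1) (fun h => h ^+ 1 * 1)) in H.
apply: (@eqO_div 1 1); apply: bigO_ext (eqO_sym H); near=> h => z _.
by rewrite mulr1 mulr0.
Unshelve. all: by end_near. Qed.

(** [K] is applied to the leading jump h D e. The term in [N] carries h theta_0, which
    [theta0_first] makes O(h^2). *)
Lemma equilibrium_second j :
  equal_mod_bigO 2 (f j) (combination (e j) (T j) (D e j)).
Proof.
have H1 : equal_mod_bigO 2 (fun h z => e j h z - f j h z)
    (fun h z => h ^+ 1 * 1 * (T j h z + 2^-1 * D e j h z)).
  apply: eqO_trans (eq_fields_eqO _ (hK j)) _.
  have := @eqO_sum R d 2 _ (index_enum 'I_q) xpredT (fun i h z => K j i h z * A i h z)
    _ (fun i _ => eqO_mull (rK j i) (jump_second i)).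
  move/eqO_trans; apply.
  apply: (@eqO_trans _ _ _ (fun h z => h ^+ 1 * 1 *
     (T j h z + 2^-1 * D e j h z - 2^-1 * (N j h z * theta0 h z)))).
    apply: eq_fields_eqO; apply: filterS (hKT j) => h H z pz; rewrite -H //.
    by rewrite mulr_sumr; apply: eq_bigr => i _; exact: mulrCA.
  apply: (@eqO_step _ _ 1 1 1).
  have := eqO_sub (eqO_refl 1 (fun h z => T j h z + 2^-1 * D e j h z))
     (eqO_scale 2^-1 (eqO_mull (rN j) theta0_first)).
  move/eqO_trans; apply; apply: eq_fields_eqO; near=> h => z _.
  by rewrite !mulr0 subr0.
apply: bigO_ext (bigO_opp H1); near=> h => z _.
by rewrite /combination; ring.
Unshelve. all: by end_near. Qed.

Lemma transport_second j :
  equal_mod_bigO 2 (D f j) (combination (D e j) (D T j) (D (D e) j)).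
Proof.
exact: (eqO_derive_combination _ (rf j) (re j) (rT j) (rDe j) (equilibrium_second j)).
Qed.

Lemma transport2_second j :
  equal_mod_bigO 2 (D (D f) j) (combination (D (D e) j) (D (D T) j) (D (D (D e)) j)).
Proof.
exact: (eqO_derive_combination _ (rDf j) (rDe j) (rDT j) (rDDe j) (transport_second j)).
Qed.

Lemma transport2_first j : equal_mod_bigO 1 (D (D f) j) (D (D e) j).
Proof. exact: (eqO_derive _ (rDf j) (rDe j) (transport_first j)). Qed.

Lemma transport3_first j : equal_mod_bigO 1 (D (D (D f)) j) (D (D (D e)) j).
Proof. exact: (eqO_derive _ (rDDf j) (rDDe j) (transport2_first j)). Qed.

(* The contributions of [D (D e)] from the first- and second-order transport terms
   cancel. *)
Lemma jump_third j : equal_mod_bigO 3 (A j)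
  (fun h z => h ^+ 1 * 1 * D e j h z - h ^+ 2 * 1 * D T j h z).
Proof.
apply: eqO_trans (eqO_le _ (hA j)) _ => //.
have := eqO_add (eqO_add (eqO_step 1 1 (transport_second j)) (eqO_step 2^-1 2 (transport2_first j)))
   (eqO_small 6^-1 (leqnn 3) (rDDDf j)).
move/eqO_trans; apply; apply: eq_fields_eqO; near=> h => z _.
by rewrite /combination; field.
Unshelve. all: by end_near. Qed.

Lemma wsum_jump c : equal_mod_bigO 3 (wsum c A)
  (fun h z => h * wsum c (D e) h z - h ^+ 2 * wsum c (D T) h z).
Proof.
apply: eqO_trans (eqO_wsum c jump_third) _; apply: eq_fields_eqO.
near=> h => z _; rewrite /wsum !mulr_sumr -sumrB; apply: eq_bigr => j _.
by ring.
Unshelve. all: by end_near. Qed.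

Lemma eq_fields_derive w F G : eq_fields F G ->
  eq_fields (fun h => 'D_w (F h)) (fun h => 'D_w (G h)).
Proof. exact: (eq_fields_iter_derive [:: w]). Qed.

Lemma derive_scale_field w (a : R) F : bigO_field 0 F ->
  eq_fields (fun h => 'D_w (fun z => a * F h z)) (fun h z => a * 'D_w (F h) z).
Proof.
move=> bF; apply: filterS (bigO_smooth bF) => h sF z pz.
by rewrite derive_scale //; exact: smooth_differentiable.
Qed.

Lemma theta_regular b : bigO_field 0 (theta b).
Proof. exact: (wsum_regular _ rDe). Qed.

Lemma theta0_regular : bigO_field 0 theta0.
Proof. exact: (wsum_regular _ rDe). Qed.

(** The velocity field enters the momentum of [T] only through u_b theta_0, which is O(h). This is
    why the final equation contains theta_b(0), free of the velocity field. *)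
Lemma momentum_T b : equal_mod_bigO 1 (momentum b T) (fun h z => sig b * theta b h z).
Proof.
apply: eqO_trans (eq_fields_eqO _ (hmomT b)) _; apply: eqO_scale.
have := eqO_sub (eqO_refl 1 (theta b)) (eqO_mull (ru b) theta0_first).
move/eqO_trans; apply; apply: eq_fields_eqO; near=> h => z _.
by rewrite mulr0 subr0.
Unshelve. all: by end_near. Qed.

Lemma total_transport_T :
  equal_mod_bigO 1 (total (D T)) (fun h z => \sum_b sig b * dx b (theta b) h z).
Proof.
apply: eqO_trans (eq_fields_eqO _ (total_transport rT)) _.
have H0 : equal_mod_bigO 1 (dt (total T)) (fun _ _ => 0).
  apply: eq_fields_eqO; have := eq_fields_derive ((0, 1) : spacetime) hmassT.
  by apply: filterS => h H z pz; rewrite [LHS]H // derive_cst.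
have Hb b : equal_mod_bigO 1 (dx b (momentum b T)) (fun h z => sig b * dx b (theta b) h z).
  apply: eqO_trans (eq_fields_eqO _ (derive_scale_field _ _ (theta_regular b))).
  apply: (eqO_derive _ _ _ (momentum_T b)); first exact: (wsum_regular _ rT).
  by apply: bigO_scale; exact: theta_regular.
have := eqO_add H0 (@eqO_sum R d 1 _ (index_enum 'I_d) xpredT _ _ (fun b _ => Hb b)).
move/eqO_trans; apply; apply: eq_fields_eqO; near=> h => z _.
by rewrite add0r.
Unshelve. all: by end_near. Qed.

Lemma theta0_second :
  equal_mod_bigO 2 theta0 (fun h z => h * \sum_b sig b * dx b (theta b) h z).
Proof.
have H := eqO_trans (eqO_sym (eq_fields_eqO 3 hmassA)) (wsum_jump (fun=> 1)).
have H1 : equal_mod_bigO 2 theta0 (fun h z => h ^+ 1 * 1 * total (D T) h z).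
  apply: (@eqO_div 1 2); apply: bigO_ext (eqO_sym H); near=> h => z _.
  rewrite /theta0 /total; move: (wsum _ (D e) h z) (wsum _ (D T) h z) => *.
  by ring.
apply: eqO_trans H1 _; apply: eqO_trans (eqO_step 1 1 total_transport_T) _.
by apply: eq_fields_eqO; near=> h => z _; rewrite mulr1 expr1.
Unshelve. all: by end_near. Qed.

Local Opaque transport.

(** The density row of [hA] divided by h. [D f] is kept, since [total_transport_f] treats its total
    through first moments. The coefficient of D (D (D e)) is 1/6 from Taylor's formula minus 1/4
    from the expansion of D (D f), that is -1/12. *)
Lemma total_expansion : equal_mod_bigO 3 (fun h z => total (D f) h z
   + h / 2 * total (D (D e)) h z - h ^+ 2 / 2 * total (D (D T)) h z
   - h ^+ 2 / 12 * total (D (D (D e))) h z) (fun _ _ => 0).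
Proof.
have H := eqO_trans (eqO_sym (eq_fields_eqO 4 hmassA)) (eqO_wsum (fun=> 1) hA).
have H1 : equal_mod_bigO 3 (fun h z => total (D f) h z + h ^+ 1 * 2^-1 * total (D (D f)) h z
   + h ^+ 2 * 6^-1 * total (D (D (D f))) h z) (fun _ _ => 0).
  apply: (@eqO_div 1 3); apply: bigO_ext (eqO_sym H); near=> h => z _.
  rewrite mulr0 !subr0 !mulrDr !mulr_sumr -!big_split /=; apply: eq_bigr => j _.
  by move: (D _ _ _ _) (D _ _ _ _) (D _ _ _ _) => *; ring.
apply: eqO_trans H1.
have H2 : equal_mod_bigO 2 (total (D (D f)))
    (fun h z => total (D (D e)) h z - h * total (D (D T)) h z - h / 2 * total (D (D (D e))) h z).
  apply: eqO_trans (eqO_wsum (fun=> 1) transport2_second) _.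
  apply: eq_fields_eqO; near=> h => z _.
  rewrite /total /wsum !mulr_sumr -!sumrB; apply: eq_bigr => j _.
  by rewrite /combination; move: (D _ _ _ _) (D _ _ _ _) (D _ _ _ _) => *; ring.
have H3 := eqO_wsum (fun=> 1) transport3_first.
have := eqO_add (eqO_add (eqO_refl 3 (total (D f))) (eqO_step 2^-1 1 H2)) (eqO_step 6^-1 2 H3).
move/eqO_sym; apply: eqO_trans; apply: eq_fields_eqO; near=> h => z _.
have id (x1 x2 x3 x4 : R) : x1 + h / 2 * x2 - h ^+ 2 / 2 * x3 - h ^+ 2 / 12 * x4
   = x1 + h ^+ 1 * 2^-1 * (x2 - h * x3 - h / 2 * x4) + h ^+ 2 * 6^-1 * x4 by field.
exact: id.
Unshelve. all: by end_near. Qed.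

(** The first moments of f are exchanged for those of e through [hmomA], with the jump known up to
    O(h^3). The coefficients are 1 / s_b here; they become sigma_b only after combination with the
    totals of D (D e) and D (D T). *)
Lemma total_transport_f : equal_mod_bigO 3 (total (D f)) (fun h z =>
  dt (total f) h z + \sum_b dx b (momentum b e) h z
  - h * (\sum_b sinv b * dx b (theta b) h z)
  + h ^+ 2 * (\sum_b sinv b * dx b (momentum b (D T)) h z)).
Proof.
apply: eqO_trans (eq_fields_eqO _ (total_transport rf)) _.
have Hb b : equal_mod_bigO 3 (dx b (momentum b f)) (fun h z => dx b (momentum b e) h z
    - h * (sinv b * dx b (theta b) h z) + h ^+ 2 * (sinv b * dx b (momentum b (D T)) h z)).
  have b1 : bigO_field 0 (momentum b e) by exact: (wsum_regular _ re).
  have b2 : bigO_field 0 (momentum b A) by exact: (wsum_regular _ rA).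
  have b3 : bigO_field 0 (momentum b (D T)) by exact: (wsum_regular _ rDT).
  have b4 := theta_regular b.
  have rhs : equal_mod_bigO 3 (momentum b f) (fun h z => momentum b e h z
      - sinv b * (h * theta b h z - h ^+ 2 * momentum b (D T) h z)).
    apply: eqO_trans (eq_fields_eqO _ (hmomA b)) _.
    by apply: eqO_sub; [exact: eqO_refl|apply: eqO_scale; exact: wsum_jump].
  have br : bigO_field 0 (fun h z => momentum b e h z
      - sinv b * (h * theta b h z - h ^+ 2 * momentum b (D T) h z)).
    apply: bigO_sub => //; apply: bigO_scale; apply: bigO_sub.
      by apply: (@bigO_le _ _ _ 1) => //; exact: (bigO_stepX 1 b4).
    by apply: (@bigO_le _ _ _ 2) => //; exact: (bigO_stepX 2 b3).
  have bf : bigO_field 0 (momentum b f) by exact: (wsum_regular _ rf).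
  apply: eqO_trans (eqO_derive _ bf br rhs) _.
  apply: eq_fields_eqO.
  apply: filterS3 (bigO_smooth b1) (bigO_smooth b4) (bigO_smooth b3) => h s1 s4 s3 z pz.
  have d1 := smooth_differentiable s1 pz; have d4 := smooth_differentiable s4 pz.
  have d3 := smooth_differentiable s3 pz.
  have -> : (fun z => momentum b e h z
      - sinv b * (h * theta b h z - h ^+ 2 * momentum b (D T) h z))
     = (fun y => momentum b e h y + ((- sinv b * h) * theta b h y
         + (sinv b * h ^+ 2) * momentum b (D T) h y)).
    by apply/funext => y; move: (momentum _ _ _ _) (theta _ _ _) (momentum _ _ _ _) => *; ring.
  have e4 : differentiable (fun y => (- sinv b * h) * theta b h y) z.
    exact: (@differentiableZ _ _ _ (theta b h)).
  have e3 : differentiable (fun y => (sinv b * h ^+ 2) * momentum b (D T) h y) z.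
    exact: (@differentiableZ _ _ _ (momentum b (D T) h)).
  rewrite derive_add //; last exact: (differentiableD e4 e3).
  rewrite derive_add // !derive_scale // /dx /partial_x.
  move: ('D__ _ _) ('D__ _ _) ('D__ _ _) => x y t; ring.
have := eqO_add (eqO_refl 3 (dt (total f)))
  (@eqO_sum R d 3 _ (index_enum 'I_d) xpredT _ _ (fun b _ => Hb b)).
move/eqO_trans; apply; apply: eq_fields_eqO; near=> h => z _.
have id (x k : R) (x1 x2 x3 : 'I_d -> R) :
    x + \sum_b (x1 b - h * x2 b + k * x3 b)
    = x + \sum_b x1 b - h * (\sum_b x2 b) + k * (\sum_b x3 b).
  by rewrite big_split sumrB /= -!mulr_sumr !addrA.
exact: id.
Unshelve. all: by end_near. Qed.

(** At this precision the time derivative of theta_0 is not negligible: [theta0_second] turns it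
    into the sum in h, which later cancels its counterpart in [total_transport2_T]. *)
Lemma total_transport2_e : equal_mod_bigO 2 (total (D (D e))) (fun h z =>
  h * (\sum_b sig b * dt (dx b (theta b)) h z) + \sum_b dx b (theta b) h z).
Proof.
apply: eqO_trans (eq_fields_eqO _ (total_transport rDe)) _.
apply: eqO_add; last exact: eqO_refl.
have bS : bigO_field 0 (fun h z => \sum_b sig b * dx b (theta b) h z).
  by apply: bigO_sum => b _; apply: bigO_scale; apply: dx_regular; exact: theta_regular.
have bhS : bigO_field 0 (fun h z => h * \sum_b sig b * dx b (theta b) h z).
  by apply: (@bigO_le _ _ _ 1) => //; exact: (bigO_stepX 1 bS).
apply: eqO_trans (eqO_derive _ theta0_regular bhS theta0_second) _.
apply: eq_fields_eqO.
have sx : \forall h \near 0^'+, forall b, smooth_on pos (dx b (theta b) h).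
  by apply: filter_forall => b; exact: (bigO_smooth (dx_regular b (theta_regular b))).
apply: filterS2 (bigO_smooth bS) sx => h sS sx z pz.
rewrite derive_scale; last exact: smooth_differentiable.
have dxb b : differentiable (dx b (theta b) h) z by exact: smooth_differentiable.
rewrite derive_bigsum; last by move=> b; exact: (@differentiableZ _ _ _ (dx b (theta b) h)).
by congr (h * _); apply: eq_bigr => b _; rewrite derive_scale.
Qed.

Lemma total_transport2_T : equal_mod_bigO 1 (total (D (D T))) (fun h z =>
  \sum_b sig b * dt (dx b (theta b)) h z + \sum_b dx b (momentum b (D T)) h z).
Proof.
apply: eqO_trans (eq_fields_eqO _ (total_transport rDT)) _.
apply: eqO_add; last exact: eqO_refl.
have bS : bigO_field 0 (fun h z => \sum_b sig b * dx b (theta b) h z).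
  by apply: bigO_sum => b _; apply: bigO_scale; apply: dx_regular; exact: theta_regular.
have bT : bigO_field 0 (total (D T)) by exact: (wsum_regular _ rDT).
apply: eqO_trans (eqO_derive _ bT bS total_transport_T) _.
apply: eq_fields_eqO.
have sx : \forall h \near 0^'+, forall b, smooth_on pos (dx b (theta b) h).
  by apply: filter_forall => b; exact: (bigO_smooth (dx_regular b (theta_regular b))).
apply: filterS sx => h sx z pz.
have dxb b : differentiable (dx b (theta b) h) z by exact: smooth_differentiable.
rewrite derive_bigsum; last by move=> b; exact: (@differentiableZ _ _ _ (dx b (theta b) h)).
by apply: eq_bigr => b _; rewrite derive_scale.
Qed.

(** The factor 2 has two sources: the time derivative of the total of D (D e), and the time part of
    its first moments. The second time derivative of theta_0 is O(h) and drops out. *)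
Lemma total_transport3_e : equal_mod_bigO 1 (total (D (D (D e)))) (fun h z =>
  2 * (\sum_b dx b (dt (theta b)) h z)
  + \sum_b \sum_a dx b (dx a (wsum (fun j => v j 0 b * v j 0 a) (D e))) h z).
Proof.
apply: eqO_trans (eq_fields_eqO _ (total_transport rDDe)) _.
have bth b := theta_regular b.
have sx : \forall h \near 0^'+, forall b, smooth_on pos (dx b (theta b) h).
  by apply: filter_forall => b; exact: (bigO_smooth (dx_regular b (bth b))).
have st : \forall h \near 0^'+, forall b, smooth_on pos (theta b h).
  by apply: filter_forall => b; exact: bigO_smooth.
have bX : bigO_field 0 (fun h z => \sum_b dx b (theta b) h z).
  by apply: bigO_sum => b _; exact: dx_regular.
have H1 : equal_mod_bigO 1 (dt (total (D (D e)))) (fun h z => \sum_b dx b (dt (theta b)) h z).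
  have H : equal_mod_bigO 1 (total (D (D e))) (fun h z => \sum_b dx b (theta b) h z).
    apply: eqO_trans (eq_fields_eqO _ (total_transport rDe)) _.
    have H0 : equal_mod_bigO 1 (dt theta0) (fun _ _ => 0).
      apply: eqO_trans (eqO_derive _ theta0_regular (bigO_zero 0) theta0_first) _.
      by apply: eq_fields_eqO; near=> h => z _; exact: derive_cst.
    have := eqO_add H0 (eqO_refl 1 (fun h z => \sum_b dx b (theta b) h z)).
    by move/eqO_trans; apply; apply: eq_fields_eqO; near=> h => z _; rewrite add0r.
  have bt : bigO_field 0 (total (D (D e))) by exact: (wsum_regular _ rDDe).
  apply: eqO_trans (eqO_derive _ bt bX H) _; apply: eq_fields_eqO.
  apply: filterS2 sx st => h sx st z pz.
  rewrite derive_bigsum; last by move=> b; exact: smooth_differentiable.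
  by apply: eq_bigr => b _; exact: (smooth_derive_comm _ _ (st b)).
have Hb b : equal_mod_bigO 1 (dx b (momentum b (D (D e)))) (fun h z => dx b (dt (theta b)) h z
    + \sum_a dx b (dx a (wsum (fun j => v j 0 b * v j 0 a) (D e))) h z).
  apply: eq_fields_eqO.
  have H := eq_fields_derive ((delta_mx 0 b, 0) : spacetime)
    (wsum_transport (fun j => v j 0 b) rDe).
  have sw : \forall h \near 0^'+, forall a,
      smooth_on pos (dx a (wsum (fun j => v j 0 b * v j 0 a) (D e)) h).
    apply: filter_forall => a; apply: (@bigO_smooth _ _ 0).
    by apply: dx_regular; exact: (wsum_regular _ rDe).
  apply: filterS3 H sw (bigO_smooth (dt_regular (bth b))) => h H sw sdt z pz.
  rewrite [LHS]H //.
  have dc a : differentiable (dx a (wsum (fun j => v j 0 b * v j 0 a) (D e)) h) z.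
    exact: smooth_differentiable.
  rewrite derive_add; first last.
  - exact: differentiable_bigsum.
  - exact: (smooth_differentiable sdt pz).
  by rewrite derive_bigsum.
have := eqO_add H1 (@eqO_sum R d 1 _ (index_enum 'I_d) xpredT _ _ (fun b _ => Hb b)).
move/eqO_trans; apply; apply: eq_fields_eqO; near=> h => z _.
have id (x1 x2 : 'I_d -> R) :
    \sum_b x1 b + \sum_b (x1 b + x2 b) = 2 * (\sum_b x1 b) + \sum_b x2 b.
  by rewrite big_split /= addrA mulrDl mul1r.
exact: id.
Unshelve. all: by end_near. Qed.

(** With 1 / s_b = sigma_b + 1 / 2, the halves cancel against h / 2 times the total of D (D e) and
    h^2 / 2 times that of D (D T). The factor 2 of [total_transport3_e], times 1 / 12, gives the
    coefficient 1 / 6. *)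
Lemma third_order_expansion : equal_mod_bigO 3
  (fun h z => dt (total f) h z + \sum_b dx b (momentum b e) h z
     - h * (\sum_b sig b * dx b (theta b) h z))
  (fun h z => - (h ^+ 2 * \sum_b sig b * dx b (momentum b (D T)) h z)
     + h ^+ 2 / 12 * (\sum_b \sum_a dx b (dx a (wsum (fun j => v j 0 b * v j 0 a) (D e))) h z)
     + h ^+ 2 / 6 * (\sum_b dx b (dt (theta b)) h z)).
Proof.
have H := bigO_add (bigO_sub total_expansion total_transport_f)
  (bigO_add (bigO_sub (eqO_step 2^-1 2 total_transport2_T) (eqO_step 2^-1 1 total_transport2_e))
     (eqO_step 12^-1 2 total_transport3_e)).
apply: bigO_ext H; near=> h => z _.
have sinvE (g : 'I_d -> R) :
    \sum_b sinv b * g b = \sum_b sig b * g b + 2^-1 * \sum_b g b.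
  by rewrite mulr_sumr -big_split; apply: eq_bigr => b _; rewrite /= -mulrDl subrK.
(* With the sums abstracted to real numbers, the elimination is a polynomial identity; [w1] stands
   for the sum of the sigma_b d_t d_b theta_b and disappears from the result. *)
have id (a1 a2 a3 x a4 y a5 a6 w1 t1 t2 t3 t4 S1 S2 : R) :
  S1 = a3 + 2^-1 * x -> S2 = a4 + 2^-1 * y ->
  t1 + h / 2 * t2 - h ^+ 2 / 2 * t3 - h ^+ 2 / 12 * t4 - 0
  - (t1 - (a1 + a2 - h * S1 + h ^+ 2 * S2))
  + (h ^+ 2 * 2^-1 * t3 - h ^+ 2 * 2^-1 * (w1 + y)
     - (h ^+ 1 * 2^-1 * t2 - h ^+ 1 * 2^-1 * (h * w1 + x))
     + (h ^+ 2 * 12^-1 * t4 - h ^+ 2 * 12^-1 * (2 * a6 + a5)))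
  = a1 + a2 - h * a3 - (- (h ^+ 2 * a4) + h ^+ 2 / 12 * a5 + h ^+ 2 / 6 * a6).
  by move=> -> ->; field.
by apply: id; exact: sinvE.
Unshelve. all: by end_near. Qed.

End Expansion.

(** * The scheme *)

Section Moments.
Context {R : realType} {q : nat}.
Variables (M : 'M[R]_q) (s : 'I_q -> R) (k0 : 'I_q).
Hypotheses (unitM : M \in unitmx) (k0_0 : k0 = 0%N :> nat).
Hypotheses (M0 : forall j, M k0 j = 1) (s0 : s k0 = 0).
Hypothesis s_neq0 : forall k : 'I_q, (0 < k)%N -> s k != 0.
Implicit Types (x g ge : 'cV[R]_q) (X : 'I_q -> R).

Lemma pos_index (l : 'I_q) : (0 < l)%N = (l != k0).
Proof. by rewrite lt0n -val_eqE /= k0_0. Qed.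

Lemma sum_pos_index X : \sum_(l < q | (0 < l)%N) X l = \sum_l X l - X k0.
Proof.
by rewrite [in RHS](bigD1 k0) //= [RHS]addrC addKr; apply: eq_bigl => l; exact: pos_index.
Qed.

Definition moment X l := \sum_i M l i * X i.

Lemma moment0 X : moment X k0 = \sum_i X i.
Proof. by apply: eq_bigr => i _; rewrite M0 mul1r. Qed.

Lemma momentB X Y l : moment (fun i => X i - Y i) l = moment X l - moment Y l.
Proof. by rewrite /moment -sumrB; apply: eq_bigr => i _; rewrite mulrBr. Qed.

Lemma moment_inv X j : \sum_l invmx M j l * moment X l = X j.
Proof.
pose x : 'cV[R]_q := \col_i X i.
have := congr1 (fun y : 'cV[R]_q => y j 0) (mulKmx unitM x).
rewrite !mxE => <-; apply: eq_bigr => l _; congr (_ * _); rewrite mxE.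
by apply: eq_bigr => i _; rewrite !mxE.
Qed.

Lemma inv_moment X k : moment (fun j => \sum_l invmx M j l * X l) k = X k.
Proof.
pose x : 'cV[R]_q := \col_i X i.
have := congr1 (fun y : 'cV[R]_q => y k 0) (mulKVmx unitM x).
rewrite !mxE => <-; apply: eq_bigr => l _; congr (_ * _); rewrite mxE.
by apply: eq_bigr => i _; rewrite !mxE.
Qed.

Lemma moment_jump X E k :
  moment (fun j => \sum_l invmx M j l * (moment X l + s l * (moment E l - moment X l)) - X j) k
  = s k * (moment E k - moment X k).
Proof. by rewrite momentB inv_moment addrC addKr. Qed.

(** On the moment l the jump is s_l times the gap to equilibrium, which can be inverted for l >= 1.
    Row 0, where s vanishes, contributes nothing to the gap because the masses agree. *)
Lemma jump_inverse X E j : \sum_i X i = \sum_i E i ->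
  E j - X j = \sum_i (\sum_(l < q | (0 < l)%N) invmx M j l * (s l)^-1 * M l i)
     * (\sum_l invmx M i l * (moment X l + s l * (moment E l - moment X l)) - X i).
Proof.
move=> XE.
pose A i := \sum_l invmx M i l * (moment X l + s l * (moment E l - moment X l)) - X i.
transitivity (\sum_(l < q | (0 < l)%N) invmx M j l * ((s l)^-1 * moment A l)).
  rewrite (eq_bigr (fun l => invmx M j l * moment (fun i => E i - X i) l)).
    by rewrite sum_pos_index moment_inv momentB !moment0 XE subrr mulr0 subr0.
  by move=> l l0; rewrite moment_jump momentB mulKf // s_neq0.
under eq_bigr => l _ do rewrite {1}/moment !mulr_sumr.
rewrite exchange_big; apply: eq_bigr => i _.
rewrite mulr_suml; apply: eq_bigr => l _.
by rewrite !mulrA.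
Qed.

(** Since 1 / s_l = sigma_l + 1 / 2, the halves sum up to half the identity once row 0 is restored,
    and the last term subtracts that row. *)
Lemma henon_inverse X j :
  \sum_i (\sum_(l < q | (0 < l)%N) invmx M j l * (s l)^-1 * M l i) * X i
  = \sum_(l < q | (0 < l)%N) henon s l * (invmx M j l * moment X l)
    + 2^-1 * X j - 2^-1 * (invmx M j k0 * \sum_i X i).
Proof.
rewrite -addrA.
have -> : 2^-1 * X j - 2^-1 * (invmx M j k0 * \sum_i X i)
    = \sum_(l < q | (0 < l)%N) 2^-1 * (invmx M j l * moment X l).
  by rewrite sum_pos_index -mulr_sumr moment_inv moment0.
rewrite -big_split /=.
under [RHS]eq_bigr => l _ do rewrite -mulrDl subrK /moment !mulr_sumr.
rewrite exchange_big /=; apply: eq_bigr => i _.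
rewrite mulr_suml; apply: eq_bigr => l _.
by rewrite !mulrA; congr (_ * _ * _); exact: mulrC.
Qed.

(** The vector is M^-1 applied to the moments sigma_k m_k with a zero in row 0; this gives both the
    vanishing mass of [T] and its momentum. *)
Lemma moment_henon X k : moment (fun j =>
    \sum_(l < q | (0 < l)%N) henon s l * (invmx M j l * moment X l)) k
  = if (0 < k)%N then henon s k * moment X k else 0.
Proof.
rewrite -[RHS](inv_moment (fun k => if (0 < k)%N then henon s k * moment X k else 0)).
rewrite /moment; apply: eq_bigr => j _; congr (_ * _).
rewrite big_mkcond; apply: eq_bigr => l _.
by case: ifP => _; [rewrite mulrCA|rewrite mulr0].
Qed.

End Moments.

(** The scheme is brought under [third_order_expansion]. Among the identities required there, only
    the expansion of the jump uses the lattice; the others are linear algebra at each point. *)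
Theorem mainTheorem1 (R : realType) (d q : nat) (hdq : (d < q)%N)
  (lambda : R) (origin : R -> 'rV[R]_d) (v : 'I_q -> 'rV[R]_d)
  (P : 'I_q -> mpoly d R) (s : 'I_q -> R) (feq : R -> 'cV[R]_q)
  (ut : R -> spacetime R d -> 'rV[R]_d) (f : R -> spacetime R d -> 'cV[R]_q)
  (lambda_gt0 : 0 < lambda)
  (v_lattice : forall (h : R) (x : 'rV[R]_d) (j : 'I_q), 0 < h ->
     cartesian_lattice (origin h) (lambda * h) x ->
     cartesian_lattice (origin h) (lambda * h) (x + h *: v j))
  (P_density : forall k : 'I_q, k = 0%N :> nat -> P k = 1)
  (P_momentum : forall b : 'I_d, P (momentum_index hdq b) = mpolyX R (mnm1 b))
  (M_invertible : forall u : 'rV[R]_d, moment_matrix P v u \in unitmx)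
  (s_density : forall k : 'I_q, k = 0%N :> nat -> s k = 0)
  (s_neq0 : forall k : 'I_q, (0 < k)%N -> s k != 0)
  (feq_conservation : forall r : R, density (feq r) = r)
  (feq_smooth : forall j : 'I_q, smooth (fun r => feq r j 0))
  (ut_regular : forall a : 'I_d, regular_field (fun h z => ut h z 0 a))
  (f_regular : forall j : 'I_q, regular_field (fun h z => f h z j 0))
  (scheme : \forall h \near 0^'+,
     lattice_boltzmann P v s feq h
       (cartesian_lattice (origin h) (lambda * h)) (ut h) (f h)) :
  let rho h z := density (f h z) in
  let fe h z := feq (rho h z) in
  let sigma b := henon s (momentum_index hdq b) in
  let theta h := conservation_default P v (fe h) in
  let theta0 h b := theta h (momentum_index hdq b) (fun=> 0) in
  equal_mod_bigO 3
    (fun h z =>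
       partial_t (rho h) z
       + \sum_(b < d) partial_x b (equilibrium_momentum v (fe h) b) z
       - h * \sum_(b < d) sigma b * partial_x b (theta0 h b) z)
    (fun h z =>
       - (h ^+ 2 * \sum_(b < d) \sum_(j < q) \sum_(l < q | (0 < l)%N)
           sigma b * henon s l * v j 0 b *
           partial_x b
             (particular_derivative (v j)
                (fun y => invmx (moment_matrix P v (ut h y)) j l
                          * theta h l (ut h) y)) z)
       + h ^+ 2 / 12 * (\sum_(b < d) \sum_(c < d) \sum_(j < q)
           v j 0 b * v j 0 c *
           partial_x b
             (partial_x c
                (particular_derivative (v j) (fun y => fe h y j 0))) z)
       + h ^+ 2 / 6 * (\sum_(b < d) partial_x b (partial_t (theta0 h b)) z)).
Proof.
move=> rho fe sigma theta theta0.
have q0 : (0 < q)%N by exact: leq_ltn_trans (leq0n d) hdq.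
pose k0 : 'I_q := Ordinal q0.
pose M h z := moment_matrix P v (ut h z).
pose ff j h z := f h z j 0.
pose ee j h z := fe h z j 0.
pose AA j h z := relaxation P v s feq (ut h z) (f h z) j 0 - ff j h z.
(* Index 0 must be left out of [K] and [TT]: as s_0 = 0, the conventional inverse is 0 and
   [henon s k0] would be -1/2, a value without meaning. *)
pose K j i h z := \sum_(l < q | (0 < l)%N) invmx (M h z) j l * (s l)^-1 * M h z l i.
pose X h z i := transport v ee i h z.
pose TT j h z := \sum_(l < q | (0 < l)%N)
   henon s l * (invmx (M h z) j l * moment (M h z) (X h z) l).
pose N j h z := invmx (M h z) j k0.
pose uu b h z := ut h z 0 b.
pose sinv b := (s (momentum_index hdq b))^-1.
have uM h z : M h z \in unitmx by exact: M_invertible.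
have M0 u j : moment_matrix P v u k0 j = 1 by rewrite mxE P_density // meval1.
have Mb u b j : moment_matrix P v u (momentum_index hdq b) j = v j 0 b - u 0 b.
  by rewrite mxE P_momentum mevalXU !mxE.
have s0 : s k0 = 0 by exact: s_density.
have rM k j : bigO_field 0 (fun h z => M h z k j) by exact: moment_matrix_regular.
have rI j l : bigO_field 0 (fun h z => invmx (M h z) j l).
  exact: invmx_moment_matrix_regular.
have rf : regular ff by move=> j; exact: f_regular.
have rrho : bigO_field 0 rho by apply: bigO_sum => j _; exact: rf.
have re : regular ee by move=> j; exact: (bigO_comp (feq_smooth j) rrho).
have rX := transport_regular v re.
have rth l : bigO_field 0 (fun h z => moment (M h z) (X h z) l).
  by apply: bigO_sum => i _; apply: bigO_mul0l; [exact: rM|exact: rX].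
have rB j l : bigO_field 0 (fun h z => invmx (M h z) j l * moment (M h z) (X h z) l).
  by apply: bigO_mul0l.
have rT : regular TT by move=> j; apply: bigO_sum => l _; exact: bigO_scale.
have relaxE h z j : relaxation P v s feq (ut h z) (f h z) j 0
   = \sum_l invmx (M h z) j l * (moment (M h z) (fun i => ff i h z) l
       + s l * (moment (M h z) (fun i => ee i h z) l - moment (M h z) (fun i => ff i h z) l)).
  by rewrite mxE; apply: eq_bigr => l _; rewrite !mxE.
have rA : regular AA.
  move=> j; apply: bigO_sub; last exact: rf.
  have rm (Y : 'I_q -> R -> spacetime R d -> R) l :
      regular Y -> bigO_field 0 (fun h z => moment (M h z) (fun i => Y i h z) l).
    by move=> rY; apply: bigO_sum => i _; apply: bigO_mul0l; [exact: rM|exact: rY].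
  have rr : bigO_field 0 (fun h z => \sum_l invmx (M h z) j l * (moment (M h z) (fun i => ff i h z) l
       + s l * (moment (M h z) (fun i => ee i h z) l - moment (M h z) (fun i => ff i h z) l))).
    apply: bigO_sum => l _; apply: bigO_mul0l => //; apply: bigO_add; first exact: rm.
    by apply: bigO_scale; apply: bigO_sub; exact: rm.
  by apply: bigO_ext rr; near=> h => z _; rewrite relaxE.
have tot h z : \sum_i ff i h z = \sum_i ee i h z.
  by rewrite -[RHS]/(density (feq (rho h z))) feq_conservation.
have momA h z k : moment (M h z) (fun j => AA j h z) k
    = s k * (moment (M h z) (fun i => ee i h z) k - moment (M h z) (fun i => ff i h z) k).
  rewrite -(moment_jump s (uM h z) (fun i => ff i h z) (fun i => ee i h z)).
  by congr moment; apply/funext => j; rewrite /AA relaxE.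
have hA j : equal_mod_bigO 4 (AA j) (fun h z =>
   h ^+ 1 * 1 * transport v ff j h z + h ^+ 2 * 2^-1 * transport v (transport v ff) j h z
   + h ^+ 3 * 6^-1 * transport v (transport v (transport v ff)) j h z).
  have tw0 : 0 <= ((v j, 1) : spacetime R d).2 by exact: ler01.
  (* The defect of the transport relation seen from the departure point, [AA + ff] being f^*. *)
  pose E h z := ff j h (z + h *: ((v j, 1) : spacetime R d)) - (AA j h z + ff j h z).
  have bE : bigO_field 0 E.
    apply: bigO_sub; first exact: (bigO_translate tw0 (rf j)).
    by apply: bigO_add; [exact: rA|exact: rf].
  have vE : vanishes_on_grid lambda origin E.
    apply: filterS2 scheme near0_gt0 => h sch h0 z [Lz [n n0 zn]].
    rewrite /E /AA subrK.
    have Lx := v_lattice _ _ j h0 Lz.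
    (* The scheme is invoked at the arrival point, which [v_lattice] places on the lattice. *)
    have := sch (z.1 + h *: v j) n j Lx; rewrite /= addrK -zn.
    case: z {Lz zn Lx} => x t /= Hx.
    by apply/eqP; rewrite subr_eq0 -Hx /ff; apply/eqP; congr (f h (_, _ + _) j 0); exact: mulr1.
  have b4 := bigO_vanishing lambda_gt0 4 bE vE.
  (* Subtracting the defect from the Taylor rest replaces the translated f by f^*; the term k = 0 of
     the sum then turns f^* into the jump. *)
  apply: bigO_ext (bigO_sub (bigO_taylor_rest 4 tw0 (rf j)) b4); near=> h => z _.
  rewrite /taylor_rest !big_ord_recr big_ord0 /= /E /transport.
  have f2 : (2`! = 2)%N by []. have f3 : (3`! = 6)%N by [].
  rewrite f2 f3 !fact0 (_ : 1`! = 1%N) // !expr0 !divr1 !expr1 !mulr1 !mul1r add0r.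
  move: (ff j h _) (AA j h z) (ff j h z) ('D__ _ _) ('D__ _ _) ('D__ _ _) => a b c x y t.
  by ring.
have hmassA : eq_fields (total AA) (fun _ _ => 0).
  near=> h => z _; rewrite /total /wsum; under eq_bigr do rewrite mul1r.
  rewrite -(moment0 (M0 (ut h z))) momA s0 mul0r //.
have hK j : eq_fields (fun h z => ee j h z - ff j h z) (fun h z => \sum_i K j i h z * AA i h z).
  near=> h => z _.
  rewrite (jump_inverse (uM h z) (erefl : k0 = 0%N :> nat) (M0 (ut h z)) s_neq0 j (tot h z)).
  by apply: eq_bigr => i _; rewrite /AA relaxE.
(* The momentum row of M(u) is v_b - u_b, so a first moment is that row plus u_b times the mass. *)
have wM h z b (Y : 'I_q -> R) : \sum_i v i 0 b * Y i
    = moment (M h z) Y (momentum_index hdq b) + ut h z 0 b * \sum_i Y i.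
  rewrite /moment mulr_sumr -big_split; apply: eq_bigr => i _.
  by rewrite /= Mb -mulrDl subrK.
have hmomA b : eq_fields (momentum v b ff)
    (fun h z => momentum v b ee h z - sinv b * momentum v b AA h z).
  near=> h => z pz; rewrite /momentum /wsum !(wM h z) momA tot.
  have -> : \sum_i AA i h z = 0.
    by rewrite -(moment0 (M0 (ut h z))) momA s0 mul0r.
  rewrite mulr0 addr0 mulKf; last exact: s_neq0.
  by rewrite opprB addrA addrAC [RHS]addrC; ring.
have hKT j : eq_fields (fun h z => \sum_i K j i h z * transport v ee i h z)
  (fun h z => TT j h z + 2^-1 * transport v ee j h z
     - 2^-1 * (N j h z * total (transport v ee) h z)).
  near=> h => z _.
  rewrite (henon_inverse s (uM h z) (erefl : k0 = 0%N :> nat) (M0 (ut h z)) (X h z) j).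
  by congr (_ - _ * (_ * _)); apply: eq_bigr => i _; rewrite mul1r.
have hmassT : eq_fields (total TT) (fun _ _ => 0).
  near=> h => z _; rewrite /total /wsum; under eq_bigr do rewrite mul1r.
  by rewrite -(moment0 (M0 (ut h z))) (moment_henon s (uM h z)).
have hmomT b : eq_fields (momentum v b TT) (fun h z => (sinv b - 2^-1) *
    (momentum v b (transport v ee) h z - uu b h z * total (transport v ee) h z)).
  near=> h => z _; rewrite /momentum /total /wsum !(wM h z).
  rewrite (moment_henon s (uM h z)) /=.
  have -> : \sum_i TT i h z = 0.
    by rewrite -(moment0 (M0 (ut h z))) (moment_henon s (uM h z)).
  under [X in _ - uu b h z * X]eq_bigr do rewrite mul1r.
  by rewrite mulr0 addr0 /uu addrK.
have rK j i : bigO_field 0 (K j i).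
  apply: bigO_sum => l _; apply: bigO_mul0l => //.
  by apply: bigO_ext (bigO_scale (s l)^-1 (rI j l)); near=> h => z _; rewrite mulrC.
have rN : regular N by move=> j; exact: rI.
have main := third_order_expansion rf re rT rA rK rN ut_regular hA hmassA hK hmomA hKT hmassT hmomT.

(* Derivatives given in coordinates are now identified with directional ones. They agree only where
   the field is differentiable, hence for small h and positive times. *)
have pdE (w : 'rV[R]_d) F : bigO_field 0 F -> eq_fields (fun h => particular_derivative w (F h))
    (fun h => 'D_((w, 1) : spacetime R d) (F h)).
  move=> bF; apply: filterS (bigO_smooth bF) => h sF z pz.
  by rewrite /= derive_basis ?mul1r //; exact: smooth_differentiable.
have pdX : \forall h \near 0^'+, forall j z, positive_time z ->
    particular_derivative (v j) (ee j h) z = X h z j.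
  by apply: filter_forall => j; exact: pdE.
(* At zero velocity the momentum row of the moment matrix is v_b itself, so theta_b(0) is the first
   moment of D e. *)
have th0E b : eq_fields (fun h => theta0 h b) (momentum v b (transport v ee)).
  apply: filterS pdX => h pdX z pz.
  rewrite /theta0 /theta /conservation_default /momentum /wsum; apply: eq_bigr => j _.
  by rewrite Mb mxE subr0; congr (_ * _); exact: pdX.
have thE l : eq_fields (fun h => theta h l (ut h)) (fun h z => moment (M h z) (X h z) l).
  apply: filterS pdX => h pdX z pz.
  rewrite /theta /conservation_default /moment; apply: eq_bigr => j _.
  by congr (_ * _); exact: pdX.
have pBE j l : eq_fields (fun h => particular_derivative (v j)
       (fun y => invmx (moment_matrix P v (ut h y)) j l * theta h l (ut h) y))
    (fun h => 'D_((v j, 1) : spacetime R d)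
       (fun z => invmx (M h z) j l * moment (M h z) (X h z) l)).
  have H : eq_fields (fun h y => invmx (moment_matrix P v (ut h y)) j l * theta h l (ut h) y)
     (fun h z => invmx (M h z) j l * moment (M h z) (X h z) l).
    by apply: filterS (thE l) => h H z pz; rewrite H.
  have b1 := bigO_ext (eq_fields_sym H) (rB j l).
  have := eq_fields_derive ((v j, 1) : spacetime R d) H.
  by apply: filterS2 (pdE (v j) _ b1) => h H1 H2 z pz; rewrite H1 // H2.
have dxB : \forall h \near 0^'+, forall b j l z, positive_time z ->
    partial_x b (particular_derivative (v j)
       (fun y => invmx (moment_matrix P v (ut h y)) j l * theta h l (ut h) y)) z
    = partial_x b ('D_((v j, 1) : spacetime R d)
       (fun z => invmx (M h z) j l * moment (M h z) (X h z) l)) z.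
  apply: filter_forall => b; apply: filter_forall => j; apply: filter_forall => l.
  exact: (eq_fields_derive ((delta_mx 0 b, 0) : spacetime R d) (pBE j l)).
have sB : \forall h \near 0^'+, forall j l, smooth_on (@positive_time R d)
    (fun z => invmx (M h z) j l * moment (M h z) (X h z) l).
  by apply: filter_forall => j; apply: filter_forall => l; exact: (bigO_smooth (rB j l)).
(* The Hénon parameters are constants, so they leave both derivatives; the factor M^-1 theta_l
   varies with the velocity field and stays inside. *)
have term1 : eq_fields (fun h z => \sum_b (sinv b - 2^-1) * dx b (momentum v b (transport v TT)) h z)
  (fun h z => \sum_(b < d) \sum_(j < q) \sum_(l < q | (0 < l)%N)
     sigma b * henon s l * v j 0 b *
     partial_x b (particular_derivative (v j)
       (fun y => invmx (moment_matrix P v (ut h y)) j l * theta h l (ut h) y)) z).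
  apply: filterS3 dxB sB (regular_differentiable (transport_regular v rT)) => h dxB sB dT z pz.
  apply: eq_bigr => b _; rewrite /dx /partial_x derive_wsum; last by move=> j; exact: dT.
  rewrite mulr_sumr; apply: eq_bigr => j _.
  have sDB l : smooth_on (@positive_time R d) ('D_((v j, 1) : spacetime R d)
      (fun z => invmx (M h z) j l * moment (M h z) (X h z) l)).
    by apply: smooth_derive; exact: sB.
  have -> : 'D_((delta_mx 0 b, 0) : spacetime R d) (transport v TT j h) z
     = \sum_(l < q | (0 < l)%N) henon s l *
       partial_x b ('D_((v j, 1) : spacetime R d)
         (fun z => invmx (M h z) j l * moment (M h z) (X h z) l)) z.
    have E : eq_pos (transport v TT j h) (fun z => \sum_(l < q | (0 < l)%N) henon s l *
       'D_((v j, 1) : spacetime R d) (fun z => invmx (M h z) j l * moment (M h z) (X h z) l) z).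
      move=> y py; rewrite /transport derive_bigsum.
        apply: eq_bigr => l _; rewrite derive_scale //; exact: smooth_differentiable.
      move=> l; apply: (@differentiableZ _ _ _
        (fun z => invmx (M h z) j l * moment (M h z) (X h z) l)).
      exact: smooth_differentiable.
    rewrite (eq_pos_derive _ E) // derive_bigsum.
      apply: eq_bigr => l _; rewrite derive_scale //; exact: smooth_differentiable.
    move=> l; apply: (@differentiableZ _ _ _ ('D_((v j, 1) : spacetime R d)
        (fun z => invmx (M h z) j l * moment (M h z) (X h z) l))).
    exact: smooth_differentiable.
  have scaleS (a c : R) (g : 'I_q -> R) : a * (c * \sum_(l < q | (0 < l)%N) g l)
     = \sum_(l < q | (0 < l)%N) a * (c * g l) by rewrite !mulr_sumr.
  rewrite [LHS]scaleS; apply: eq_bigr => l _; rewrite -/(partial_x _ _ z) dxB // /sigma /henon /sinv.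
  by move: (partial_x _ _ _) => x; ring.
have pXE j : eq_fields (fun h => particular_derivative (v j) (fun y => fe h y j 0))
    (transport v ee j).
  exact: (pdE (v j) _ (re j)).
have dxX : \forall h \near 0^'+, forall b c j z, positive_time z ->
    partial_x b (partial_x c (particular_derivative (v j) (fun y => fe h y j 0))) z
    = partial_x b (partial_x c (transport v ee j h)) z.
  apply: filter_forall => b; apply: filter_forall => c; apply: filter_forall => j.
  apply: (eq_fields_derive ((delta_mx 0 b, 0) : spacetime R d)).
  exact: (eq_fields_derive ((delta_mx 0 c, 0) : spacetime R d) (pXE j)).
have sX : \forall h \near 0^'+, forall j, smooth_on (@positive_time R d) (transport v ee j h).
  by apply: filter_forall => j; exact: (bigO_smooth (rX j)).
have term2 : eq_fields
  (fun h z => \sum_b \sum_c dx b (dx c (wsum (fun j => v j 0 b * v j 0 c) (transport v ee))) h z)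
  (fun h z => \sum_(b < d) \sum_(c < d) \sum_(j < q) v j 0 b * v j 0 c *
     partial_x b (partial_x c (particular_derivative (v j) (fun y => fe h y j 0))) z).
  apply: filterS2 dxX sX => h dxX sX z pz.
  apply: eq_bigr => b _; apply: eq_bigr => c _.
  have E : eq_pos (dx c (wsum (fun j => v j 0 b * v j 0 c) (transport v ee)) h)
     (fun z => \sum_j v j 0 b * v j 0 c * partial_x c (transport v ee j h) z).
    by move=> y py; rewrite /dx /partial_x derive_wsum // => j; exact: smooth_differentiable.
  rewrite [LHS](eq_pos_derive _ E) //.
  rewrite (@derive_wsum R d q _ (fun j => v j 0 b * v j 0 c)
    (fun j => partial_x c (transport v ee j h))).
    by apply: eq_bigr => j _; rewrite dxX.
  by move=> j; apply: (smooth_differentiable (smooth_derive _ (sX j))).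
have term3 : eq_fields
  (fun h z => \sum_b dx b (dt (momentum v b (transport v ee))) h z)
  (fun h z => \sum_(b < d) partial_x b (partial_t (fun z => theta0 h b z)) z).
  have H : \forall h \near 0^'+, forall b z, positive_time z ->
      partial_x b (partial_t (theta0 h b)) z = dx b (dt (momentum v b (transport v ee))) h z.
    apply: filter_forall => b.
    apply: (eq_fields_derive ((delta_mx 0 b, 0) : spacetime R d)).
    exact: (eq_fields_derive ((0, 1) : spacetime R d) (th0E b)).
  by apply: filterS H => h H z pz; apply: eq_bigr => b _; rewrite H.
have dxth0 : \forall h \near 0^'+, forall b z, positive_time z ->
    partial_x b (theta0 h b) z = dx b (momentum v b (transport v ee)) h z.
  apply: filter_forall => b.
  exact: (eq_fields_derive ((delta_mx 0 b, 0) : spacetime R d) (th0E b)).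
apply: bigO_ext main.
apply: filterS3 (filterI term1 term2) term3 dxth0 => h [t1 t2] t3 t0 z pz.
have id (a a' b c c' x x' y y' w w' : R) :
    a = a' -> c = c' -> x = x' -> y = y' -> w = w' ->
    a + b - h * c - (- (h ^+ 2 * x) + h ^+ 2 / 12 * y + h ^+ 2 / 6 * w)
    = a' + b - h * c' - (- (h ^+ 2 * x') + h ^+ 2 / 12 * y' + h ^+ 2 / 6 * w').
  by move=> -> -> -> -> ->.
apply: id; [| |exact: t1|exact: t2|exact: t3].
- congr (partial_t _ z); apply/funext => y; rewrite /total /wsum.
  by apply: eq_bigr => j _; rewrite mul1r.
- by apply: eq_bigr => b _; rewrite t0.
Unshelve. all: by end_near. Qed.
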